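(* Let $\Bbbk$ be an algebraically closed field of characteristic zero, and let $A_1,\ldots,A_m$ be finite-dimensional $\Bbbk$-algebras ($m\ge 1$). For each $i$, let $J(A_i)$ denote the Jacobson radical of $A_i$, let $\overline{J(A_i)}\subseteq(A_i)_{\natural}$ denote its image in the cocenter, and let $\iota_i\colon(A_i)_{\natural}\to(A_1*\cdots*A_m)_{\natural}$ be the linear map induced by the canonical homomorphism $A_i\to A_1*\cdots*A_m$. Then $$\operatorname{Rad}_{\mathrm{tr}}(A_1*\cdots*A_m)=\bigoplus_{i=1}^{m}\iota_i\bigl(\overline{J(A_i)}\bigr)$$ as an internal direct sum of subspaces of $(A_1*\cdots*A_m)_{\natural}$. Consequently, $A_1*\cdots*A_m$ is trace-RFD if and only if $J(A_i)\subseteq[A_i,A_i]$ for every $i\in\{1,\ldots,m\}$.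
   Context: An algebra means a nonzero associative unital $\Bbbk$-algebra. A finite-dimensional representation of an algebra $C$ is a unital $\Bbbk$-algebra homomorphism $\rho\colon C\to\operatorname{End}_{\Bbbk}(V)$ with $V$ a nonzero finite-dimensional $\Bbbk$-vector space. An algebra $C$ is residually finite-dimensional (RFD) if for every nonzero $c\in C$ there is a finite-dimensional representation $\rho$ of $C$ with $\rho(c)\neq0$. The cocenter of $C$ is the vector space $C_{\natural}:=C/[C,C]$, where $[C,C]$ is the $\Bbbk$-linear span of all commutators $xy-yx$ with $x,y\in C$; the class of $c\in C$ is denoted $\overline c$. Each finite-dimensional representation $\rho$ induces a linear functional $\operatorname{tr}(-)(\rho)\colon C_{\natural}\to\Bbbk$, $\overline c\mapsto\operatorname{tr}(\rho(c))$. The trace radical of $C$ is $$\operatorname{Rad}_{\mathrm{tr}}(C):=\bigcap_{\rho}\ker\bigl(\operatorname{tr}(-)(\rho)\bigr)\subseteq C_{\natural},$$ where $\rho$ ranges over all finite-dimensional representations of $C$. An algebra $C$ is trace residually finite-dimensional (trace-RFD) if it is RFD and, in addition, for every nonzero $\overline c\in C_{\natural}$ there is a finite-dimensional representation $\rho$ of $C$ with $\operatorname{tr}(\overline c)(\rho)\neq0$. The free product $A_1*\cdots*A_m$ is the coproduct of $A_1,\ldots,A_m$ in the category of unital $\Bbbk$-algebras. *)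

(* Defs.v *)
From HB Require Import structures.
From mathcomp Require Import all_boot all_order all_algebra all_field.
From mathcomp Require Import mathcomp_extra boolp classical_sets.

Set Implicit Arguments.
Unset Strict Implicit.
Unset Printing Implicit Defensive.

Import GRing.Theory.
Local Open Scope quotient_scope.
Local Open Scope classical_set_scope.
Local Open Scope ring_scope.

Section Cocenter.
Variables (k : fieldType) (C : algType k).

Definition comm_span : {pred C} := fun c =>
  `[< exists s : seq (k * (C * C)),
        c = \sum_(t <- s) t.1 *: (t.2.1 * t.2.2 - t.2.2 * t.2.1) >].

Lemma comm_spanP c :
  reflect (exists s : seq (k * (C * C)),
             c = \sum_(t <- s) t.1 *: (t.2.1 * t.2.2 - t.2.2 * t.2.1))
          (c \in comm_span).
Proof. exact: asboolP. Qed.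

Lemma comm_span_scale (a : k) : {in comm_span, forall c, a *: c \in comm_span}.
Proof.
move=> c /comm_spanP[s ->]; apply/comm_spanP.
exists [seq (a * t.1, t.2) | t <- s].
by rewrite big_map scaler_sumr; apply: eq_bigr => t _; rewrite scalerA.
Qed.

Lemma comm_span_zmod : zmod_closed comm_span.
Proof.
split=> [|c d /comm_spanP[s ->] /(comm_span_scale (-1)) /comm_spanP[t dE]].
  by apply/comm_spanP; exists [::]; rewrite big_nil.
apply/comm_spanP; exists (s ++ t).
by rewrite big_cat -dE scaleN1r.
Qed.

HB.instance Definition _ := GRing.isZmodClosed.Build C comm_span comm_span_zmod.

Definition cocenter : Type := Quotient.quot comm_span.

HB.instance Definition _ := GRing.Zmodule.on cocenter.

Definition cocenter_pi (c : C) : cocenter := \pi_(Quotient.quot comm_span) c.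

Lemma cocenter_piP (c d : C) :
  cocenter_pi c = cocenter_pi d <-> c - d \in comm_span.
Proof. by rewrite Quotient.idealrBE; split=> [/eqP|/eqP]. Qed.

Lemma cocenter_pi_surj (x : cocenter) : exists c, x = cocenter_pi c.
Proof. by exists (repr x); rewrite /cocenter_pi reprK. Qed.

Lemma cocenter_piB : zmod_morphism cocenter_pi.
Proof. exact: raddfB. Qed.

HB.instance Definition _ :=
  GRing.isZmodMorphism.Build C cocenter cocenter_pi cocenter_piB.

Lemma comm_span_repr (c : C) : c - repr (cocenter_pi c) \in comm_span.
Proof. by apply/cocenter_piP; rewrite /cocenter_pi reprK. Qed.

Definition cocenter_scale (a : k) (x : cocenter) : cocenter :=
  cocenter_pi (a *: repr x).

Lemma cocenter_scaleE a c :
  cocenter_scale a (cocenter_pi c) = cocenter_pi (a *: c).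
Proof.
apply/esym/cocenter_piP; rewrite -scalerBr comm_span_scale //.
exact: comm_span_repr.
Qed.

Lemma cocenter_scaleA a b x :
  cocenter_scale a (cocenter_scale b x) = cocenter_scale (a * b) x.
Proof.
by have [c ->] := cocenter_pi_surj x; rewrite !cocenter_scaleE scalerA.
Qed.

Lemma cocenter_scale1 : left_id 1 cocenter_scale.
Proof.
by move=> x; have [c ->] := cocenter_pi_surj x; rewrite cocenter_scaleE scale1r.
Qed.

Lemma cocenter_scaleDr : right_distributive cocenter_scale +%R.
Proof.
move=> a x y; have [c ->] := cocenter_pi_surj x.
have [d ->] := cocenter_pi_surj y.
by rewrite -raddfD !cocenter_scaleE -raddfD scalerDr.
Qed.

Lemma cocenter_scaleDl x : {morph cocenter_scale^~ x : a b / a + b}.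
Proof.
move=> a b; have [c ->] := cocenter_pi_surj x.
by rewrite !cocenter_scaleE -raddfD scalerDl.
Qed.

HB.instance Definition _ := GRing.Zmodule_isLmodule.Build k cocenter
  cocenter_scaleA cocenter_scale1 cocenter_scaleDr cocenter_scaleDl.

Lemma cocenter_pi_scalable : scalable cocenter_pi.
Proof. by move=> a c; rewrite -cocenter_scaleE. Qed.

HB.instance Definition _ :=
  GRing.isScalable.Build k C cocenter *:%R cocenter_pi cocenter_pi_scalable.

End Cocenter.
Arguments comm_span {k} C _ : assert.
Arguments cocenter {k} C.

Section CocenterMap.
Variables (k : fieldType) (C D : algType k) (f : {lrmorphism C -> D}).

Lemma comm_span_map c : c \in comm_span C -> f c \in comm_span D.
Proof.
move=> /comm_spanP[s ->]; apply/comm_spanP.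
exists [seq (t.1, (f t.2.1, f t.2.2)) | t <- s].
rewrite big_map linear_sum; apply: eq_bigr => t _.
by rewrite linearZ_LR /= rmorphB /= !rmorphM.
Qed.

Definition cocenter_map (x : cocenter C) : cocenter D := cocenter_pi (f (repr x)).

Lemma cocenter_mapE c : cocenter_map (cocenter_pi c) = cocenter_pi (f c).
Proof.
apply/esym/cocenter_piP; rewrite -raddfB comm_span_map //.
exact: comm_span_repr.
Qed.

Lemma cocenter_map_linear : linear cocenter_map.
Proof.
move=> a x y; have [c ->] := cocenter_pi_surj x.
have [d ->] := cocenter_pi_surj y.
by rewrite -linearP !cocenter_mapE linearP -[RHS]linearP.
Qed.

HB.instance Definition _ := GRing.isSemilinear.Build k (cocenter C) (cocenter D) _
  cocenter_map (GRing.semilinear_linear cocenter_map_linear).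

End CocenterMap.

Definition lfun_trace (k : fieldType) (V : vectType k) (f : 'End(V)) : k :=
  \tr (passmx.mxof (vbasis fullv) (vbasis fullv) f).

(* The product of [lfun_algType] is composition in diagrammatic order, hence
   the explicit unit and product conditions. *)
Record fd_rep (k : fieldType) (C : algType k) := FdRep {
  rep_space : vectType k;
  rep_space_neq0 : (0 < \dim {:rep_space})%N;
  rep_fun :> {linear C -> 'End(rep_space)};
  rep_fun1 : rep_fun 1 = \1%VF;
  rep_funM : forall c d, rep_fun (c * d) = (rep_fun c \o rep_fun d)%VF
}.

Section Trace.
Variables (k : fieldType) (C : algType k) (rho : fd_rep C).

Definition rep_trace (c : C) : k := lfun_trace (rho c).

Lemma rep_trace_linear : scalar rep_trace.
Proof. by move=> a c d; rewrite /rep_trace /lfun_trace (linearP rho) passmx.mxof_linear linearP. Qed.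

HB.instance Definition _ := GRing.isSemilinear.Build k C k _
  rep_trace (GRing.semilinear_linear rep_trace_linear).

Lemma rep_traceC c d : rep_trace (c * d) = rep_trace (d * c).
Proof.
rewrite /rep_trace !rep_funM /lfun_trace.
by rewrite !(passmx.mxof_comp _ _ (vbasisP fullv)) mxtrace_mulC.
Qed.

Lemma rep_trace_comm_span c : c \in comm_span C -> rep_trace c = 0.
Proof.
move=> /comm_spanP[s ->]; rewrite linear_sum big1 // => t _.
by rewrite linearZ_LR raddfB /= rep_traceC subrr mulr0.
Qed.

Definition cocenter_trace (x : cocenter C) : k := rep_trace (repr x).

Lemma cocenter_traceE c : cocenter_trace (cocenter_pi c) = rep_trace c.
Proof.
apply/esym/eqP; rewrite -subr_eq0 -linearB; apply/eqP/rep_trace_comm_span.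
exact: comm_span_repr.
Qed.

End Trace.

Definition trace_radical (k : fieldType) (C : algType k) : set (cocenter C) :=
  [set x | forall rho : fd_rep C, cocenter_trace rho x = 0].

Arguments trace_radical {k} C.

Definition RFD (k : fieldType) (C : algType k) : Prop :=
  forall c : C, c != 0 -> exists rho : fd_rep C, rho c != 0.

Definition trace_RFD (k : fieldType) (C : algType k) : Prop :=
  RFD C /\ forall x : cocenter C, x != 0 ->
    exists rho : fd_rep C, cocenter_trace rho x != 0.

(* [idealr_closed S] says that S is a proper left ideal: it asks for
   [a * u \in S] when [u \in S]. *)
Definition maximal_left_ideal (R : nzRingType) (S : {pred R}) : Prop :=
  idealr_closed S /\
  forall T : {pred R}, idealr_closed T -> {subset S <= T} -> {subset T <= S}.

Definition jacobson_radical (R : nzRingType) : set R :=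
  [set x | forall S : {pred R}, maximal_left_ideal S -> x \in S].
Arguments jacobson_radical : clear implicits.

(* Coproduct in the category of k-algebras; morphisms are compared pointwise. *)
Definition is_free_product (k : fieldType) (I : Type) (A : I -> algType k)
    (P : algType k) (iota : forall i, {lrmorphism A i -> P}) : Prop :=
  forall (B : algType k) (f : forall i, {lrmorphism A i -> B}),
    exists g : {lrmorphism P -> B},
      (forall i, g \o iota i =1 f i) /\
      forall h : {lrmorphism P -> B}, (forall i, h \o iota i =1 f i) -> h =1 g.

Definition internal_direct_sum (k : fieldType) (V : lmodType k) (I : finType)
    (W : set V) (S : I -> set V) : Prop :=
  [/\ forall i, submod_closed (mem (S i)),
      W = [set \sum_i v i | v in [set v : I -> V | forall i, S i (v i)]]
    & forall v : I -> V, (forall i, S i (v i)) -> \sum_i v i = 0 ->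
        forall i, v i = 0].

(* Main.v *)
Require Import Defs.
From HB Require Import structures.
From mathcomp Require Import all_boot all_order all_algebra all_field.
From mathcomp Require Import mathcomp_extra boolp classical_sets.
From mathcomp Require Import ring.

Set Implicit Arguments.
Unset Strict Implicit.
Unset Printing Implicit Defensive.

Import GRing.Theory passmx.
Local Open Scope classical_set_scope.
Local Open Scope ring_scope.

(** The tracelessness of nilpotents gives one inclusion.  For the others, let
    A_i act on a multiple of its regular representation, and conjugate this
    action by 1 + t^-1 X_i with X_i = U_i W_i of square zero.  The image of a
    word of length n, multiplied by t^(2n), is polynomial in t; at t = 0 it is,
    up to sign, the product of the X_i R_i X_i.  Choosing W_j U_i = 1 for i != j
    makes it vanish unless the word is alternating, and then it is essentially
    the product of the matrices W_i R_i(a) U_i, which may be any linear function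
    of a that vanishes at 1.  Taking matrices supported on an n-cycle for
    these, an element on which all representations (resp. all traces) vanish
    loses its longest words (resp. loses them modulo commutators, down to
    length 1).  Hence A_1 * ... * A_m is RFD, and a traceless element is, modulo
    commutators, a sum of traceless a_i in A_i.  Such an a_i lies in
    J(A_i) + [A_i, A_i]: a linear form killing J(A_i) + [A_i, A_i] kills the
    radical T of the form tr(xy) of the regular representation, so it is
    tr(. z) with z central modulo T, and z acts by a scalar on every simple
    module.  The sum is direct because A_i * (the others) maps to matrices over
    A_i, whose trace takes values in A_i/[A_i, A_i]. *)

(** * Matrix representations *)

Lemma comm_span_comm (k : fieldType) (C : algType k) (x y : C) :
  x * y - y * x \in comm_span C.
Proof.
by apply/comm_spanP; exists [:: (1, (x, y))]; rewrite big_seq1 scale1r.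
Qed.

Section BuildMorphism.
Variables (k : fieldType) (C : algType k) (n : nat) (f : C -> 'M[k]_n).
Hypotheses (f_lin : linear f) (f_mul : monoid_morphism f).

Definition mx_lrmorphism : {lrmorphism C -> 'M[k]_n} :=
  HB.pack f
    (GRing.isSemilinear.Build k C 'M[k]_n *:%R f (GRing.semilinear_linear f_lin))
    (GRing.isMonoidMorphism.Build C 'M[k]_n f f_mul).
End BuildMorphism.

Section MatrixReps.
Variables (k : fieldType) (C : algType k).

Lemma mx_rep_traceC n (r : {lrmorphism C -> 'M[k]_n}) c d :
  \tr (r (c * d)) = \tr (r (d * c)).
Proof. by rewrite !rmorphM mxtrace_mulC. Qed.

Lemma mx_rep_trace_comm_span n (r : {lrmorphism C -> 'M[k]_n}) c :
  c \in comm_span C -> \tr (r c) = 0.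
Proof.
move=> /comm_spanP[s ->]; rewrite !raddf_sum big1 //= => t _.
by rewrite linearZ mxtraceZ !raddfB /= mx_rep_traceC subrr mulr0.
Qed.

(** [mxof] acts on rows, so in the basis [e] the operator becomes [S *m M^T *m T], where [S] and [T]
    pass between coordinates and columns. Since [T *m S = 1%:M], cyclicity of the trace leaves the
    trace of [M^T]. *)
Lemma lfun_trace_mulmx n (M : 'M[k]_n) :
  lfun_trace (linfun (mulmx M : 'cV[k]_n -> 'cV[k]_n)) = \tr M.
Proof.
rewrite /lfun_trace; set e := vbasis fullv.
have eb : basis_of fullv e by exact: vbasisP.
pose T := lin1_mx (rVof e \o @trmx k 1 n).
pose S := lin1_mx (@trmx k n 1 \o vecof e).
have -> : mxof e e (linfun (mulmx M : 'cV[k]_n -> 'cV[k]_n)) =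
          S *m M^T *m T.
  apply/row_matrixP => i; rewrite !rowE !mulmxA !mul_rV_lin1 /=.
  by rewrite trmx_mul !trmxK lfunE.
rewrite -mulmxA mxtrace_mulC -mulmxA.
have -> : T *m S = 1%:M.
  apply/row_matrixP => i; rewrite !rowE !mulmxA !mul_rV_lin1 /= mulmx1.
  by rewrite rVofK // trmxK.
by rewrite mulmx1 mxtrace_tr.
Qed.

Lemma fd_rep_of_mx n (r : {lrmorphism C -> 'M[k]_n}) : (0 < n)%N ->
  exists rho : fd_rep C, (forall c, rep_trace rho c = \tr (r c)) /\
    (forall c, rho c = 0 -> r c = 0).
Proof.
move=> n_gt0; pose V : vectType k := 'cV[k]_n.
pose f (c : C) : 'End(V) := linfun (mulmx (r c) : 'cV[k]_n -> 'cV[k]_n).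
have f_lin : linear f.
  move=> a c d; apply/lfunP => v; rewrite lfunE add_lfunE scale_lfunE /=.
  by rewrite linearP mulmxDl -scalemxAl !lfunE /=.
pose fL : {linear C -> 'End(V)} :=
  HB.pack f (GRing.isSemilinear.Build k C 'End(V) *:%R f
    (GRing.semilinear_linear f_lin)).
have V_gt0 : (0 < \dim {:V})%N by rewrite dimvf /dim /= muln1.
have f1 : fL 1 = \1%VF.
  by apply/lfunP => v; rewrite !lfunE /= rmorph1 mul1mx.
have fM c d : fL (c * d) = (fL c \o fL d)%VF.
  by apply/lfunP => v; rewrite !lfunE /= !lfunE /= rmorphM mulmxA.
exists (FdRep V_gt0 f1 fM); split=> c; first exact: lfun_trace_mulmx.
move=> /= /lfunP c0; apply/matrixP => i j.
have /matrixP/(_ i 0) := c0 (delta_mx j 0).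
by rewrite lfunE /= -colE !mxE lfunE !mxE.
Qed.

(** [mxof] reverses the order of composition; the transpose in [f] restores it and preserves
    traces. *)
Lemma mx_of_fd_rep (rho : fd_rep C) :
  exists n (r : {lrmorphism C -> 'M[k]_n}), (0 < n)%N /\
    (forall c, rep_trace rho c = \tr (r c)).
Proof.
set V := rep_space rho; pose e := vbasis (fullv : {vspace V}).
have eb : basis_of fullv e by exact: vbasisP.
pose f c : 'M[k]_(\dim {:V}) := (mxof e e (rho c))^T.
have f_lin : linear f.
  by move=> a c d; rewrite /f linearP mxof_linear linearP.
have f_mul : monoid_morphism f.
  split; first by rewrite /f rep_fun1 mxof1 ?(basis_free eb) // trmx1.
  by move=> c d; rewrite /f rep_funM (mxof_comp _ _ eb) trmx_mul.
exists _, (mx_lrmorphism f_lin f_mul); split; first exact: rep_space_neq0.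
by move=> c; rewrite mxtrace_tr.
Qed.

End MatrixReps.

(** * Traces of nilpotent and idempotent matrices *)

Section LinearAlgebra.

(** Every eigenvalue is zero, so the characteristic polynomial, which splits over [k], is a power of
    ['X]; its subleading coefficient is minus the trace. *)
Lemma mxtrace_nilpotent (k : closedFieldType) n (M : 'M[k]_n) j :
  M ^+ j = 0 -> \tr M = 0.
Proof.
case: n M => [|n] M Mj; first by rewrite /mxtrace big_ord0.
have [s sE] := closed_field_poly_normal (char_poly M).
rewrite (monicP (char_poly_monic M)) scale1r in sE.
have s0 z : z \in s -> z = 0.
  move=> zs; have : root (char_poly M) z by rewrite sE root_prod_XsubC.
  rewrite -eigenvalue_root_char => /eigenvalueP[v vM v0].
  have : v *m (M ^+ j) = z ^+ j *: v.
    elim: j {Mj} => [|j IH]; first by rewrite !expr0 mulmx1 scale1r.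
    by rewrite exprSr mulmxA IH -scalemxAl vM scalerA exprSr.
  rewrite Mj mulmx0 => /esym/eqP; rewrite scaler_eq0 (negPf v0) orbF.
  by rewrite expf_eq0 => /andP[_ /eqP].
have sX : char_poly M = 'X^(size s).
  rewrite sE; elim: {sE}s s0 => [|z r IH] s0; first by rewrite big_nil.
  rewrite big_cons (s0 z) ?mem_head // subr0 exprS IH // => y yr.
  by apply: s0; rewrite inE yr orbT.
apply/eqP; rewrite -oppr_eq0 -char_poly_trace // sX coefXn.
have /eqP := size_char_poly M; rewrite sX size_polyXn eqSS => /eqP->.
by rewrite ltn_eqF.
Qed.

(** In a rank factorization of [E] as a column base times a row base, idempotence forces the product
    in the other order to be the identity of size [\rank E]. *)
Lemma mxtrace_idem (k : fieldType) n (E : 'M[k]_n) :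
  E *m E = E -> \tr E = (\rank E)%:R.
Proof.
move=> EE; have CR := mulmx_base E.
have RC : row_base E *m col_base E = 1%:M.
  have cI := row_full_inj (col_base_full E).
  have rI := row_free_inj (row_base_free E).
  apply: (cI); apply: (rI); rewrite /= mulmx1 -mulmxA -(mulmxA (row_base E)).
  by rewrite mulmxA CR EE.
by rewrite -{1}CR mxtrace_mulC RC mxtrace1.
Qed.
End LinearAlgebra.

(** * The regular representation and the Jacobson radical *)

Section RegularRep.
Variables (k : fieldType) (A : falgType k).
Local Notation e := (vbasis {:A}).

Lemma vbasis_fullP : basis_of {:A} e. Proof. exact: vbasisP. Qed.

Fact reg_rep_subproof : {r : {lrmorphism A -> 'M[k]_(\dim {:A})} |
  forall x a, rVof e x *m r a = rVof e (x * a)}.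
Proof.
pose f (a : A) := mxof e e (amulr a).
have f_lin : linear f by move=> c a b; rewrite /f linearP mxof_linear.
have f_mul : monoid_morphism f.
  split=> [|a b]; apply/row_matrixP => i; rewrite !rowE mul_mxof lfunE /=.
    by rewrite mulr1 vecofK ?vbasis_fullP // mulmx1.
  rewrite mulmxA mul_mxof lfunE /= mul_mxof rVofK ?vbasis_fullP //.
  by rewrite !lfunE /= mulrA.
exists (mx_lrmorphism f_lin f_mul) => x a.
by rewrite mul_mxof rVofK ?vbasis_fullP // lfunE.
Qed.

Definition reg_rep := sval reg_rep_subproof.

Lemma rVof_reg_rep x a : rVof e x *m reg_rep a = rVof e (x * a).
Proof. exact: svalP reg_rep_subproof x a. Qed.

Lemma reg_rep_inj : injective reg_rep.
Proof.
move=> a b ab; have := rVof_reg_rep 1 a; rewrite ab rVof_reg_rep !mul1r.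
by move/(can_inj (rVofK vbasis_fullP)).
Qed.

Lemma dim_falg_gt0 : (0 < \dim {:A})%N.
Proof. by rewrite adim_gt0. Qed.

End RegularRep.
Arguments vbasis_fullP {k A}.

Section NilpotentTraces.
Variables (k : fieldType) (k_pchar : [pchar k] =i pred0).

Lemma natr_pchar0_eq0 n : (n%:R == 0 :> k) = (n == 0)%N.
Proof. by move/pcharf0P: k_pchar => ->. Qed.

(* If X^j r, with r(0) != 0, annihilates M, a Bezout relation between
   X^(j+1) and r provides an idempotent E in M k[M], whose trace vanishes. *)
Lemma nilpotent_of_trace n (M : 'M[k]_n) :
  (forall i, \tr (M ^+ i.+1) = 0) -> exists j, M ^+ j = 0.
Proof.
case: n M => [|n] M trM; first by exists 0%N; apply/matrixP => -[].
have p0 : mxminpoly M != 0 by rewrite monic_neq0 // mxminpoly_monic.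
have [j [r r0 pE]] := multiplicity_XsubC (mxminpoly M) 0.
rewrite p0 /= subr0 in r0 pE; exists j.
have cop : coprimep ('X ^+ j.+1) r.
  by rewrite coprimep_expl // coprimep_sym -['X]subr0 coprimep_XsubC.
have [[u v] /= uv] := Bezout_eq1_coprimepP _ _ cop.
have hX : horner_mx M 'X = M by exact: horner_mx_X.
have pM : horner_mx M ('X^j * r) = 0 by rewrite mulrC -pE; apply: mx_root_minpoly.
pose E := horner_mx M (u * 'X ^+ j.+1).
have EE : E *m E = E.
  rewrite -[E *m E]/(E * E) -rmorphM /=.
  have -> : u * 'X ^+ j.+1 * (u * 'X ^+ j.+1) =
            u * 'X ^+ j.+1 - u * 'X * v * ('X^j * r).
    have -> : u * 'X * v * ('X^j * r) = u * 'X ^+ j.+1 * (v * r).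
      by rewrite exprS; ring.
    have -> : v * r = 1 - u * 'X ^+ j.+1 by rewrite -uv addrAC subrr add0r.
    by ring.
  by rewrite rmorphB /= [X in _ - X]rmorphM /= pM mulr0 subr0.
have trE : \tr E = 0.
  rewrite /E exprS mulrCA.
  rewrite rmorphM /= hX; set q := u * _; rewrite -[q]coefK poly_def.
  rewrite rmorph_sum mulr_sumr raddf_sum big1 //= => i _.
  by rewrite linearZ /= rmorphXn /= hX -scalerAr linearZ /= -exprS trM mulr0.
(* In characteristic zero, the trace of an idempotent determines its rank. *)
have E0 : E = 0.
  by apply/eqP; rewrite -mxrank_eq0 -natr_pchar0_eq0 -mxtrace_idem // trE.
rewrite -hX -rmorphXn -['X^j]mulr1 -uv mulrDr rmorphD /=.
rewrite [X in horner_mx M X + _]mulrC rmorphM /= -/E E0 mul0r add0r.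
by rewrite mulrCA rmorphM /= pM mulr0.
Qed.
End NilpotentTraces.

Section Jacobson.
Variables (k : fieldType) (A : falgType k).

(** Dimensions are bounded, so a proper left ideal of maximal dimension above [V] exists without
    Zorn's lemma. A proper left ideal [T] containing it is only a predicate; it is compared with [U]
    through the subspaces U + A t for t in [T]. *)
Lemma left_ideal_vspace (V : {vspace A}) :
  (forall a x, x \in V -> a * x \in V) -> 1 \notin V ->
  exists2 S : {pred A}, maximal_left_ideal S & {subset V <= S}.
Proof.
move=> Vl V1.
pose P n := `[< exists U : {vspace A}, [/\ \dim U = n, (V <= U)%VS, 1 \notin U
                 & forall a x, x \in U -> a * x \in U] >].
have exP : exists n, P n by exists (\dim V); apply/asboolP; exists V.
have ubP n : P n -> (n <= \dim {:A})%N.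
  by move=> /asboolP[U [<- _ _ _]]; rewrite dimvS ?subvf.
case: (ex_maxnP exP ubP) => n /asboolP[U [<- VU U1 Ul]] nmax.
exists (fun x => x \in U); last exact/subvP.
split=> [|T [T0 T1 TM] UT t tT].
  by split=> [|//|a x y xU yU]; rewrite ?mem0v // memvD // Ul.
have TD x y : x \in T -> y \in T -> x + y \in T.
  by move=> xT yT; rewrite -[x]mul1r TM.
have TMl a x : x \in T -> a * x \in T by move=> xT; rewrite -[_ * _]addr0 TM.
pose U' := (U + limg (amulr t))%VS.
have U'T x : x \in U' -> x \in T.
  move=> /memv_addP[y yU [_ /memv_imgP[a _ ->] ->]].
  by rewrite lfunE; apply: TD; [apply: UT|apply: TMl].
have tU' : t \in U'.
  rewrite -[t]add0r memv_add ?mem0v //; apply/memv_imgP.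
  by exists 1; rewrite ?memvf // lfunE /= mul1r.
have /nmax : P (\dim U').
  apply/asboolP; exists U'; split=> //.
  - exact: subv_trans VU (addvSl _ _).
  - by apply: contra T1 => /U'T.
  move=> a x /memv_addP[y yU [_ /memv_imgP[b _ ->] ->]].
  rewrite mulrDr memv_add ?Ul //; apply/memv_imgP; exists (a * b).
    exact: memvf.
  by rewrite !lfunE /= mulrA.
move=> dimU'; have /eqP-> // : U == U'.
by rewrite eqEdim addvSl.
Qed.

(** Otherwise the left ideal A(1 - yx) is proper, hence lies in a maximal one; that one also
    contains x, and therefore 1. *)
Lemma jacobson_left_inverse (x : A) : jacobson_radical A x ->
  forall y, exists z, z * (1 - y * x) = 1.
Proof.
move=> Jx y; apply: contrapT => nz.
have [||S Smax VS] := @left_ideal_vspace (limg (amulr (1 - y * x))).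
- move=> a _ /memv_imgP[b _ ->]; apply/memv_imgP; exists (a * b).
    exact: memvf.
  by rewrite !lfunE /= mulrA.
- apply/negP => /memv_imgP[z _ zE]; apply: nz; exists z.
  by rewrite [RHS]zE lfunE.
have [[S0 /negP S1 SM] _] := Smax; apply: S1.
have xS : x \in S by exact: Jx.
rewrite -(subrK (y * x) 1) addrC SM //; apply: VS.
by apply/memv_imgP; exists 1; rewrite ?memvf // lfunE /= mul1r.
Qed.

(** The descending chain of the A x^n is stationary, whence x^n = y x^(n+1) for some y. Then (1 -
    yx) x^n = 0, and 1 - yx has a left inverse. *)
Lemma jacobson_nilpotent (x : A) :
  jacobson_radical A x -> exists n, x ^+ n = 0.
Proof.
move=> Jx.
have [n [y xn]] : exists n y, x ^+ n = y * x ^+ n.+1.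
  pose V n := limg (amulr (x ^+ n)).
  have VS n : (V n.+1 <= V n)%VS.
    apply/subvP => _ /memv_imgP[a _ ->]; apply/memv_imgP.
    exists (a * x); first exact: memvf.
    by rewrite !lfunE /= exprS mulrA.
  have [n Vn] : exists n, \dim (V n) = \dim (V n.+1).
    apply: contrapT => /forallNP nV.
    have dV n : (\dim (V n) + n <= \dim (V 0%N))%N.
      elim: n => [|n IH]; first by rewrite addn0.
      rewrite addnS (leq_trans _ IH) // ltn_add2r ltn_neqAle dimvS // andbT.
      by apply/eqP => /esym/nV.
    by have := dV (\dim (V 0%N)).+1; rewrite leqNgt addnS ltnS leq_addl.
  have : x ^+ n \in V n.+1.
    have /eqP-> : V n.+1 == V n by rewrite eqEdim VS -Vn leqnn.
    by apply/memv_imgP; exists 1; rewrite ?memvf // lfunE /= mul1r.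
  by move=> /memv_imgP[y _]; rewrite lfunE; exists n, y.
have [z z1] := jacobson_left_inverse Jx y.
exists n; rewrite -[x ^+ n]mul1r -z1 -mulrA mulrBl mul1r.
by rewrite -mulrA -exprS -xn subrr mulr0.
Qed.

(** If x were outside a maximal left ideal S, then S + A x would contain 1, so 1 - ax would lie in S
    for some a. The finite geometric sum of the nilpotent ax inverts 1 - ax, which puts 1 in S. *)
Lemma nil_left_ideal_jacobson (x : A) :
  (forall y, exists n, (y * x) ^+ n = 0) -> jacobson_radical A x.
Proof.
move=> nil S [[S0 S1 SM] Smax].
have SMl a z : z \in S -> a * z \in S by move=> zS; rewrite -[_ * _]addr0 SM.
pose T : {pred A} := fun t => `[< exists a, t - a * x \in S >].
have ST z : z \in S -> z \in T.
  by move=> zS; apply/asboolP; exists 0; rewrite mul0r subr0.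
have [T1|T1] := boolP (1 \in T); last first.
  apply: (Smax T) => //; last first.
    by apply/asboolP; exists 1; rewrite mul1r subrr.
  split=> [|//|a u v /asboolP[b uS] /asboolP[c vS]]; first exact: ST.
  apply/asboolP; exists (a * b + c); rewrite mulrDl opprD addrACA -mulrA.
  by rewrite -mulrBr SM.
have /asboolP[a aS] := T1; have [n axn] := nil a.
case/negP: S1; have := SMl (\sum_(i < n) (a * x) ^+ i) _ aS.
have cS : GRing.comm (a * x - 1) (\sum_(i < n) (a * x) ^+ i).
  by apply: commr_sum => i _; apply: commrX; apply/commr_sym/commrB;
     [exact: commr_refl|exact: commr1].
by rewrite -opprB mulrN -cS -subrX1 axn sub0r opprK.
Qed.
End Jacobson.

(** * Traceless elements of finite-dimensional algebras *)

(** In a basis adapted to [U] and a complement, all [r c] are block triangular, and the two diagonal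
    blocks are representations. *)
Lemma stable_trace_split (k : fieldType) (C : algType k) n
    (r : {lrmorphism C -> 'M[k]_n}) (U : 'M[k]_n) :
  (forall c, (U *m r c <= U)%MS) ->
  exists (r1 : {lrmorphism C -> 'M[k]_(\rank U)})
         (r2 : {lrmorphism C -> 'M[k]_(\rank U^C)}),
    forall c, \tr (r c) = \tr (r1 c) + \tr (r2 c).
Proof.
move=> Ur; pose B := row_base U; pose B' := row_base U^C%MS.
pose P := col_mx B B'.
have Pfull : row_full P.
  rewrite -sub1mx -addsmxE (adds_eqmx (eq_row_base _) (eq_row_base _)).
  by rewrite sub1mx addsmx_compl_full.
have Pfree : row_free P.
  rewrite /row_free (eqP Pfull) mxrank_compl subnKC //; exact: rank_leq_row.
have PQ : P *m pinvmx P = 1%:M by exact: mulmxVp.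
have QP : pinvmx P *m P = 1%:M by exact: mulVpmx.
pose Q1 := lsubmx (pinvmx P); pose Q2 := rsubmx (pinvmx P).
have QE : pinvmx P = row_mx Q1 Q2 by rewrite hsubmxK.
have {QP} QB : Q1 *m B + Q2 *m B' = 1%:M by rewrite -QP QE mul_row_col.
move: PQ; rewrite QE mul_col_row scalar_mx_block => /eq_block_mx.
case=> BQ1 BQ2 BQ1' BQ2'.
have BrQ2 c : B *m r c *m Q2 = 0.
  have /submxP[X ->] : (B *m r c <= B)%MS by rewrite stablemx_row_base Ur.
  by rewrite -mulmxA BQ2 mulmx0.
have ins m p (X : 'M_(m, n)) (Y : 'M_(n, p)) :
    X *m Y = X *m Q1 *m (B *m Y) + X *m Q2 *m (B' *m Y).
  by rewrite !mulmxA -mulmxDl -!mulmxA -mulmxDr QB mulmx1.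
pose f1 c := B *m r c *m Q1; pose f2 c := B' *m r c *m Q2.
have l1 : linear f1.
  move=> a c d; rewrite /f1 linearP mulmxDr mulmxDl.
  by rewrite -scalemxAr -scalemxAl.
have l2 : linear f2.
  move=> a c d; rewrite /f2 linearP mulmxDr mulmxDl.
  by rewrite -scalemxAr -scalemxAl.
have m1 : monoid_morphism f1.
  split=> [|c d]; first by rewrite /f1 rmorph1 mulmx1 BQ1.
  rewrite /f1 rmorphM -[LHS]mulmxA -[r c * r d *m _]mulmxA mulmxA ins.
  rewrite BrQ2 mul0mx addr0.
  by rewrite [B *m (_ *m _)]mulmxA.
have m2 : monoid_morphism f2.
  split=> [|c d]; first by rewrite /f2 rmorph1 mulmx1 BQ2'.
  rewrite /f2 rmorphM -[LHS]mulmxA -[r c * r d *m _]mulmxA mulmxA ins.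
  by rewrite [B *m (_ *m _)]mulmxA BrQ2 mulmx0 add0r [B' *m (_ *m _)]mulmxA.
exists (mx_lrmorphism l1 m1), (mx_lrmorphism l2 m2) => c /=.
rewrite -[in LHS](mulmx1 (r c)) -QB mulmxDr mxtraceD (mulmxA _ Q1) (mulmxA _ Q2).
rewrite (mxtrace_mulC (r c *m Q1)) (mxtrace_mulC (r c *m Q2)).
by rewrite (mulmxA B) (mulmxA B').
Qed.

Section CentralTrace.
Variables (k : closedFieldType) (k_pchar : [pchar k] =i pred0) (A : falgType k).
Local Notation e := (vbasis {:A}).
Local Notation d := (\dim {:A}).

(** The radical of the trace form, a two-sided ideal. It serves as a substitute for the Jacobson
    radical that is cut out by explicit linear equations, those of [reg_gram]. *)
Definition reg_trace_radical (x : A) := forall y, \tr (reg_rep A (x * y)) = 0.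

Lemma reg_trace_radical_nilpotent x :
  reg_trace_radical x -> exists n, x ^+ n = 0.
Proof.
move=> Tx; have [|j rj] := nilpotent_of_trace k_pchar (M := reg_rep A x).
  by move=> i; rewrite -rmorphXn exprS Tx.
by exists j; apply: reg_rep_inj; rewrite rmorphXn rj rmorph0.
Qed.

Lemma reg_trace_radicalMl x y : reg_trace_radical x -> reg_trace_radical (y * x).
Proof.
move=> Tx z; rewrite -mulrA mx_rep_traceC.
by rewrite -mulrA Tx.
Qed.

Lemma reg_trace_radicalMr x y : reg_trace_radical x -> reg_trace_radical (x * y).
Proof. by move=> Tx z; rewrite -mulrA Tx. Qed.

Lemma reg_trace_radical_jacobson x :
  reg_trace_radical x -> jacobson_radical A x.
Proof.
move=> Tx; apply: nil_left_ideal_jacobson => y.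
exact/reg_trace_radical_nilpotent/reg_trace_radicalMl.
Qed.

Definition reg_gram : 'M[k]_d :=
  \matrix_(i, j) \tr (reg_rep A (e`_i * e`_j)).

Lemma reg_gramE x (g : 'cV[k]_d) :
  (rVof e x *m reg_gram *m g) 0 0 = \tr (reg_rep A (x * vecof e g^T)).
Proof.
rewrite mxE [in RHS](coord_vbasis (memvf x)) /vecof.
rewrite mulr_sumr !raddf_sum /=; apply: eq_bigr => j _.
rewrite mxE mulr_suml mulr_suml !raddf_sum; apply: eq_bigr => i _ /=.
rewrite !mxE -scalerAl -scalerAr !linearZ /=.
by ring.
Qed.

Lemma reg_trace_radicalP x :
  reg_trace_radical x <-> rVof e x *m reg_gram = 0.
Proof.
split=> [Tx|x0 y]; last first.
  have := reg_gramE x (rVof e y)^T; rewrite x0 mul0mx mxE trmxK.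
  by rewrite rVofK ?vbasis_fullP.
apply/rowP => j; have := reg_gramE x (delta_mx j 0).
by rewrite Tx -colE !mxE.
Qed.

(** Induction on the dimension: a reducible representation splits into smaller ones as far as traces
    are concerned. On an irreducible one the trace-form radical acts by zero, so [z] commutes with
    the action and, by Schur's lemma, is a scalar. *)
Lemma central_mod_radical_trace (a z : A) :
  (forall n (r : {lrmorphism A -> 'M[k]_n}), \tr (r a) = 0) ->
  (forall y, reg_trace_radical (y * z - z * y)) ->
  forall n (r : {lrmorphism A -> 'M[k]_n}), \tr (r (a * z)) = 0.
Proof.
move=> tra zc n; have [N] := ubnP n; elim: N n => // N IH n leN r.
have [[U [Us U0 Un]]|irr] :=
    pselect (exists U : 'M[k]_n,
      [/\ forall c, (U *m r c <= U)%MS, (0 < \rank U)%N & (\rank U < n)%N]).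
  have [r1 [r2 ->]] := stable_trace_split Us.
  rewrite !IH ?addr0 //; last exact: leq_trans Un leN.
  rewrite mxrank_compl (leq_trans _ (leN : n <= N)%N) // ltn_subrL U0.
  by rewrite (leq_trans U0) // ltnW.
case: n r leN irr => [|n] r leN irr; first by rewrite /mxtrace big_ord0.
have {}irr m (U : 'M[k]_(m, n.+1)) :
    (forall c, (U *m r c <= U)%MS) -> U != 0 -> (1%:M <= U)%MS.
  move=> Us U0; rewrite sub1mx; apply: contrapT => Ufull; apply: irr.
  exists <<U>>%MS; rewrite genmxE lt0n mxrank_eq0; split=> [c|//|].
    by rewrite (eqmxMr _ (genmxE U)) genmxE.
  rewrite ltn_neqAle rank_leq_col andbT; exact/negP.
(* If v t is nonzero, with t in the trace-form radical T, the stable subspace v T is everything, so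
   v = v x with x in T. But x is nilpotent, which forces v = 0. *)
have T0 t : reg_trace_radical t -> r t = 0.
  move=> Tt; apply/row_matrixP => i; rewrite row0 rowE.
  set v := delta_mx 0 i; apply: contrapT => /eqP vt.
  pose L := lin1_mx (mulmx v \o r \o vecof e).
  have LE x : rVof e x *m L = v *m r x.
    by rewrite mul_rV_lin1 /= rVofK ?vbasis_fullP.
  pose U := kermx reg_gram *m L.
  have TU x : reg_trace_radical x -> (v *m r x <= U)%MS.
    by move=> /reg_trace_radicalP xG; rewrite -LE submxMr //; apply/sub_kermxP.
  have UT (w : 'rV_n.+1) : (w <= U)%MS ->
      exists2 x, reg_trace_radical x & w = v *m r x.
    move=> /submxP[D ->]; exists (vecof e (D *m kermx reg_gram)).
      apply/reg_trace_radicalP; rewrite vecofK ?vbasis_fullP //.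
      by rewrite -mulmxA mulmx_ker mulmx0.
    by rewrite -LE vecofK ?vbasis_fullP // mulmxA.
  have U1 : (1%:M <= U)%MS.
    apply: irr => [c|].
      apply/row_subP => j; rewrite row_mul.
      have [x Tx ->] := UT _ (row_sub j U).
      by rewrite -mulmxA -[r x *m r c]rmorphM; apply/TU/reg_trace_radicalMr.
    by apply: contraNneq vt => U0; have /submxP[D ->] := TU _ Tt; rewrite U0 mulmx0.
  have [x Tx vx] := UT v (submx_trans (submx1 _) U1).
  have [j xj] := reg_trace_radical_nilpotent Tx.
  have vxj : v *m r (x ^+ j) = v.
    elim: j {xj} => [|j IHj]; first by rewrite rmorph1 mulmx1.
    by rewrite exprSr rmorphM mulmxA IHj -vx.
  by case/eqP: vt; rewrite -vxj xj rmorph0 mulmx0 mul0mx.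
have zr c : r z *m r c = r c *m r z.
  apply/eqP; rewrite eq_sym -subr_eq0; apply/eqP.
  by rewrite -[RHS](T0 _ (zc c)) rmorphB !rmorphM.
have /closed_rootP[l] : size (char_poly (r z)) != 1%N by rewrite size_char_poly.
rewrite -eigenvalue_root_char /eigenvalue => E0.
have /irr/(_ E0) : forall c, (eigenspace (r z) l *m r c <= eigenspace (r z) l)%MS.
  move=> c; apply/eigenspaceP; rewrite -mulmxA -zr mulmxA.
  by rewrite (eigenspaceP (submx_refl _)) scalemxAl.
move=> /eigenspaceP; rewrite mul1mx => rz.
have -> : r (a * z) = r a *m r z by exact: rmorphM.
by rewrite rz -scalemxAr mulmx1 linearZ /= tra mulr0.
Qed.

(** [K] holds the coordinates of T + [A, A], with T the trace-form radical. Membership of [a] is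
    tested on the columns of [cokermx K], that is, on linear forms vanishing on [K]. *)
Lemma traceless_decomposition (a : A) :
  (forall n (r : {lrmorphism A -> 'M[k]_n}), \tr (r a) = 0) ->
  exists2 b, jacobson_radical A b & a - b \in comm_span A.
Proof.
move=> tra; pose cm i j : 'rV_d := rVof e (e`_i * e`_j - e`_j * e`_i).
pose K := (kermx reg_gram + \sum_(i < d) \sum_(j < d) <<cm i j>>)%MS.
have [|aK] := boolP (rVof e a <= K)%MS.
  move=> /sub_addsmxP[[u v] /= aE].
  exists (vecof e (u *m kermx reg_gram)).
    apply/reg_trace_radical_jacobson/reg_trace_radicalP.
    by rewrite vecofK ?vbasis_fullP // -mulmxA mulmx_ker mulmx0.
  rewrite -[a in a - _](rVofK vbasis_fullP) aE linearD addrC addKr.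
  have /sub_sumsmxP[w ->] := submxMl v (\sum_(i < d) \sum_(j < d) <<cm i j>>)%MS.
  rewrite linear_sum rpred_sum //= => i _.
  have /sub_sumsmxP[w' ->] := submxMl (w i) (\sum_(j < d) <<cm i j>>)%MS.
  rewrite linear_sum rpred_sum //= => j _.
  have : (w' j *m <<cm i j>> <= cm i j)%MS.
    by rewrite (submx_trans (submxMl _ _)) // genmxE.
  move=> /sub_rVP[c ->]; rewrite linearZ comm_span_scale //=.
  by rewrite rVofK ?vbasis_fullP // comm_span_comm.
exfalso; move: aK; rewrite submxE => /eqP; apply.
apply/rowP => j; rewrite [RHS]mxE.
pose f := col j (cokermx K).
have fK m (X : 'M_(m, d)) : (X <= K)%MS -> X *m f = 0.
  rewrite submxE => /eqP XK.
  by rewrite /f colE mulmxA XK mul0mx.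
have -> : (rVof e a *m cokermx K) 0 j = (rVof e a *m f) 0 0.
  by rewrite mxE [RHS]mxE; apply: eq_bigr => i _; rewrite [f i 0]mxE.
(* The form [f] kills the kernel of the Gram matrix, hence factors through it: this represents [f]
   as the trace against some [z]. *)
have fG : f = reg_gram *m (pinvmx reg_gram *m f).
  have : (1%:M - reg_gram *m pinvmx reg_gram <= kermx reg_gram)%MS.
    by apply/sub_kermxP; rewrite mulmxBl mul1mx mulmxKpV ?submx_refl // subrr.
  move=> h; have /eqP := fK _ _ (submx_trans h (addsmxSl _ _)).
  by rewrite mulmxBl mul1mx subr_eq0 -(mulmxA reg_gram) => /eqP.
rewrite fG mulmxA reg_gramE; set z := vecof e _.
have fE x : (rVof e x *m f) 0 0 = \tr (reg_rep A (x * z)).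
  by rewrite fG mulmxA reg_gramE.
(* That [f] vanishes on every xy - yx says that [z] is central modulo the trace-form radical. *)
apply: central_mod_radical_trace => // y x.
have : (rVof e (x * y - y * x) *m f) 0 0 = 0.
  have -> : x * y - y * x = \sum_(i < d) \sum_(j < d)
      (rVof e x 0 i * rVof e y 0 j) *: (e`_i * e`_j - e`_j * e`_i).
    rewrite -[x in LHS](rVofK vbasis_fullP) -[y in LHS](rVofK vbasis_fullP) /vecof.
    rewrite mulr_suml mulr_sumr -sumrB; apply: eq_bigr => i _.
    rewrite mulr_sumr mulr_suml -sumrB; apply: eq_bigr => j' _.
    by rewrite -!scalerAl -!scalerAr !scalerA scalerBr [in X in _ - X]mulrC.
  rewrite fK ?mxE // linear_sum summx_sub //= => i _.
  rewrite linear_sum summx_sub //= => i' _.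
  rewrite linearZ scalemx_sub //= (submx_trans _ (addsmxSr _ _)) //.
  by rewrite (sumsmx_sup i) // (sumsmx_sup i') // genmxE.
rewrite fE !mulrBl !raddfB /= => /eqP; rewrite subr_eq0 => /eqP xyz.
apply/eqP; rewrite subr_eq0; apply/eqP.
by rewrite [LHS]mx_rep_traceC mulrA xyz [LHS]mx_rep_traceC mulrA.
Qed.

End CentralTrace.

(** * Words in a free product *)

Section SubalgebraType.
Variables (k : fieldType) (P : algType k) (S : {pred P}).
Hypothesis S_alg : subalg_closed S.

(** The closure proof is an argument, so that the subalgebra structure can be attached to a
    predicate whose closure is only a hypothesis. *)
Definition subalg_pred of subalg_closed S : {pred P} := S.

HB.instance Definition _ :=
  GRing.isSubalgClosed.Build k P (subalg_pred S_alg) S_alg.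

Record subalg_type := SubalgType
  { subalg_val :> P; subalg_valP : subalg_val \in subalg_pred S_alg }.

HB.instance Definition _ := [isSub for subalg_val].
HB.instance Definition _ := [Choice of subalg_type by <:].
HB.instance Definition _ := [SubChoice_isSubAlgebra of subalg_type by <:].

End SubalgebraType.

Section BuildMorphism.
Variables (k : fieldType) (C B : algType k) (f : C -> B).
Hypotheses (f_lin : linear f) (f_mul : monoid_morphism f).

Definition alg_lrmorphism : {lrmorphism C -> B} :=
  HB.pack f (GRing.isSemilinear.Build k C B *:%R f (GRing.semilinear_linear f_lin))
    (GRing.isMonoidMorphism.Build C B f f_mul).
End BuildMorphism.

Section FreeProduct.
Variables (k : fieldType) (I : eqType) (A : I -> algType k) (P : algType k).
Variable iota : forall i, {lrmorphism A i -> P}.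
Hypothesis hP : is_free_product iota.

(** The universal property maps [P] into the subalgebra [S]. Followed by the inclusion, this map
    agrees with the identity on each [A i], so it is the identity. *)
Lemma free_product_subalg (S : {pred P}) :
  subalg_closed S -> (forall i a, iota i a \in S) -> forall x, x \in S.
Proof.
move=> S_alg iS; pose Q : algType k := subalg_type S_alg.
pose f i a : Q := SubalgType (iS i a : iota i a \in subalg_pred S_alg).
have f_lin i : linear (f i) by move=> c a b; apply: val_inj; rewrite /= linearP.
have f_mul i : monoid_morphism (f i).
  by split=> [|a b]; apply: val_inj; rewrite /= (rmorph1, rmorphM).
have [g [gf _]] := hP (fun i => alg_lrmorphism (f_lin i) (f_mul i)).
have v_lin : linear (val : Q -> P) by [].
have v_mul : monoid_morphism (val : Q -> P) by split.
pose v := alg_lrmorphism v_lin v_mul.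
have [h [hi hu]] := hP iota.
move=> x; have -> : x = v (g x).
  have -> : v (g x) = h x.
    apply: (hu [the {lrmorphism P -> P} of v \o g]) => i a /=.
    by rewrite -[g _]/((g \o iota i) a) gf.
  by apply: (hu [the {lrmorphism P -> P} of idfun]).
exact: valP.
Qed.

Lemma free_product_mx n (r : forall i, {lrmorphism A i -> 'M[k]_n}) :
  (0 < n)%N ->
  exists g : {lrmorphism P -> 'M[k]_n}, forall i a, g (iota i a) = r i a.
Proof.
(* Only matrices of positive size form a nonzero algebra, as [algType] demands. *)
case: n r => // n r _.
have [g [gr _]] := hP (B := 'M[k]_n.+1) r.
by exists g => i a; have := gr i a.
Qed.

Local Notation letter := {i : I & A i}.
Definition eval_letter (l : letter) : P := iota (tag l) (tagged l).
Definition eval_word (w : seq letter) : P := \prod_(l <- w) eval_letter l.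
Definition eval_sum (s : seq (k * seq letter)) : P :=
  \sum_(t <- s) t.1 *: eval_word t.2.

Definition words_le n (x : P) :=
  exists2 s, x = eval_sum s & all (fun t => size t.2 <= n)%N s.

Lemma words_leW m n x : (m <= n)%N -> words_le m x -> words_le n x.
Proof.
move=> mn [s -> /allP sm]; exists s => //; apply/allP => t /sm.
by move=> /leq_trans; apply.
Qed.

Lemma words_le0 n : words_le n 0.
Proof. by exists [::]; rewrite // /eval_sum big_nil. Qed.

Lemma words_leD n x y : words_le n x -> words_le n y -> words_le n (x + y).
Proof.
move=> [s -> sn] [t -> tn]; exists (s ++ t); last by rewrite all_cat sn.
by rewrite /eval_sum big_cat.
Qed.

Lemma words_leZ n c x : words_le n x -> words_le n (c *: x).
Proof.
move=> [s -> sn]; exists [seq (c * t.1, t.2) | t <- s]; last by rewrite all_map.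
by rewrite /eval_sum scaler_sumr big_map; apply: eq_bigr => t _; rewrite scalerA.
Qed.

Lemma words_le_sum n (T : Type) (r : seq T) (Q : pred T) (F : T -> P) :
  (forall i, Q i -> words_le n (F i)) -> words_le n (\sum_(i <- r | Q i) F i).
Proof.
by move=> FQ; apply: big_ind => //; [apply: words_le0|apply: words_leD].
Qed.

Lemma words_le_word w : words_le (size w) (eval_word w).
Proof.
by exists [:: (1, w)]; rewrite /eval_sum ?big_seq1 ?scale1r //= leqnn.
Qed.

Lemma words_le_letter l : words_le 1 (eval_letter l).
Proof. by have := words_le_word [:: l]; rewrite /eval_word big_seq1. Qed.

Lemma words_le_scalar c : words_le 0 (c *: 1).
Proof.
by apply: words_leZ; have := words_le_word [::]; rewrite /eval_word big_nil.
Qed.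

Lemma words_leM m n x y : words_le m x -> words_le n y -> words_le (m + n) (x * y).
Proof.
move=> [s -> /allP sm] [t -> /allP tn].
rewrite /eval_sum mulr_suml big_seq; apply: words_le_sum => u us.
rewrite mulr_sumr big_seq; apply: words_le_sum => v vt.
rewrite -scalerAl -scalerAr; do 2!apply: words_leZ.
have := words_le_word (u.2 ++ v.2); rewrite /eval_word big_cat /= size_cat.
by apply: words_leW; rewrite leq_add ?sm ?tn.
Qed.

(** The elements of finite length form a subalgebra containing every [A i]. *)
Lemma words_le_ex x : exists n, words_le n x.
Proof.
pose S : {pred P} := fun x => `[< exists n, words_le n x >].
suff /asboolP : x \in S by [].
apply: free_product_subalg => [|i a].
  split.
  - by apply/asboolP; exists 0%N; rewrite -[1]scale1r; apply: words_le_scalar.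
  - move=> c u v /asboolP[m um] /asboolP[n vn]; apply/asboolP; exists (maxn m n).
    apply: words_leD; last exact: words_leW (leq_maxr _ _) vn.
    by apply: words_leZ; apply: words_leW (leq_maxl _ _) um.
  move=> u v /asboolP[m um] /asboolP[n vn]; apply/asboolP; exists (m + n)%N.
  exact: words_leM.
apply/asboolP; exists 1%N; exact: (words_le_letter (Tagged A a : letter)).
Qed.

End FreeProduct.

(** * Deformed representations *)

Section PolynomialFunctions.
Variable k : fieldType.

Definition polyfun (f : k -> k) := exists p : {poly k}, forall t, f t = p.[t].

Lemma polyfun_cst c : polyfun (fun=> c).
Proof. by exists c%:P => t; rewrite hornerC. Qed.

Lemma polyfun_id : polyfun id.
Proof. by exists 'X => t; rewrite hornerX. Qed.

Lemma polyfunD f g : polyfun f -> polyfun g -> polyfun (fun t => f t + g t).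
Proof. by move=> [p fp] [q gq]; exists (p + q) => t; rewrite hornerD fp gq. Qed.

Lemma polyfunM f g : polyfun f -> polyfun g -> polyfun (fun t => f t * g t).
Proof. by move=> [p fp] [q gq]; exists (p * q) => t; rewrite hornerM fp gq. Qed.

Lemma polyfunX f n : polyfun f -> polyfun (fun t => f t ^+ n).
Proof. by move=> [p fp]; exists (p ^+ n) => t; rewrite horner_exp fp. Qed.

Lemma polyfun_sum (T : Type) (r : seq T) (f : T -> k -> k) :
  (forall i, polyfun (f i)) -> polyfun (fun t => \sum_(i <- r) f i t).
Proof.
move=> fp; elim: r => [|i r [p IH]].
  by exists 0 => t; rewrite big_nil horner0.
have [q fq] := fp i; exists (q + p) => t.
by rewrite big_cons hornerD fq IH.
Qed.

Definition polymx m n (f : k -> 'M[k]_(m, n)) := forall i j, polyfun (fun t => f t i j).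

Lemma polymx_cst m n (M : 'M[k]_(m, n)) : polymx (fun=> M).
Proof. by move=> i j; apply: polyfun_cst. Qed.

Lemma polymxD m n (f g : k -> 'M[k]_(m, n)) :
  polymx f -> polymx g -> polymx (fun t => f t + g t).
Proof.
move=> fp gp i j; have [p pE] := polyfunD (fp i j) (gp i j).
by exists p => t; rewrite mxE pE.
Qed.

Lemma polymxZ m n c (f : k -> 'M[k]_(m, n)) :
  polyfun c -> polymx f -> polymx (fun t => c t *: f t).
Proof.
move=> cp fp i j; have [p pE] := polyfunM cp (fp i j).
by exists p => t; rewrite mxE pE.
Qed.

Lemma polymxM m n p (f : k -> 'M[k]_(m, n)) (g : k -> 'M[k]_(n, p)) :
  polymx f -> polymx g -> polymx (fun t => f t *m g t).
Proof.
move=> fp gp i j.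
have [|q qE] := @polyfun_sum _ (index_enum 'I_n) (fun l t => f t i l * g t l j).
  by move=> l; apply: polyfunM.
by exists q => t; rewrite mxE qE.
Qed.

Lemma polymx_prod n (T : Type) (r : seq T) (f : T -> k -> 'M[k]_n) :
  (forall l, polymx (f l)) -> polymx (fun t => \prod_(l <- r) f l t).
Proof.
move=> fp; elim: r => [|l r IH] i j.
  by have [p pE] := polymx_cst 1 i j; exists p => t; rewrite big_nil -(pE t).
have [p pE] := polymxM (fp l) IH i j.
by exists p => t; rewrite big_cons -pE.
Qed.

Lemma polyfun_mxtrace n (f : k -> 'M[k]_n) : polymx f -> polyfun (fun t => \tr (f t)).
Proof.
move=> fp; apply: (@polyfun_sum _ (index_enum 'I_n) (fun i t => f t i i)) => i.
exact: fp.
Qed.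

(** In characteristic zero, 1, ..., [size p] are distinct nonzero roots of [p], too many for a
    nonzero polynomial. *)
Lemma polyfun0 (f : k -> k) : [pchar k] =i pred0 -> polyfun f ->
  (forall t, t != 0 -> f t = 0) -> f 0 = 0.
Proof.
move=> k0 [p pE] f0; suff p0 : p = 0 by rewrite pE p0 horner0.
pose r : seq k := [seq i.+1%:R | i <- iota 0 (size p)].
apply/eqP; apply: contraT => p0.
have := @max_poly_roots _ p r p0; rewrite size_map size_iota ltnn; apply.
  apply/allP => _ /mapP[i _ ->]; apply/rootP.
  by rewrite -pE f0 // natr_pchar0_eq0.
rewrite map_inj_uniq ?iota_uniq // => i j ij.
wlog lij : i j ij / (i <= j)%N => [H|].
  by have /orP[/H->|/H->] := leq_total i j.
have /eqP : (j - i)%:R = 0 :> k by rewrite -subSS natrB ?ltnS // ij subrr.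
by rewrite natr_pchar0_eq0 // subn_eq0 => ?; apply/eqP; rewrite eqn_leq lij.
Qed.
End PolynomialFunctions.

Section LeadingTerm.
Variables (k : fieldType) (k_pchar : [pchar k] =i pred0).
Variables (I : eqType) (A : I -> algType k) (P : algType k).
Variable iota : forall i, {lrmorphism A i -> P}.
Hypothesis hP : is_free_product iota.
Local Notation letter := {i : I & A i}.

Section Deformation.
Variables (N : nat) (R : forall i, {lrmorphism A i -> 'M[k]_N}) (X : I -> 'M[k]_N).
Hypotheses (N_gt0 : (0 < N)%N) (XX : forall i, X i *m X i = 0).

Let Rl (l : letter) : 'M[k]_N := R (tag l) (tagged l).
Let Xl (l : letter) : 'M[k]_N := X (tag l).

(* Conjugating R_i by 1 + t^-1 X_i and multiplying by t^2 gives a polynomial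
   in t, of constant term - X_i R_i X_i. *)
Lemma deformation_lead (s : seq (k * seq letter)) n (Z : 'M[k]_N) :
  all (fun t => size t.2 <= n)%N s ->
  (forall r : {lrmorphism P -> 'M[k]_N}, \tr (r (eval_sum iota s) *m Z) = 0) ->
  \sum_(t <- s | size t.2 == n)
     t.1 * \tr ((\prod_(l <- t.2) (Xl l *m Rl l *m Xl l)) *m Z) = 0.
Proof.
move=> sn rZ.
have scaleM a b (B C : 'M[k]_N) : a *: B * (b *: C) = (a * b) *: (B * C).
  by rewrite -[LHS]/((a *: B) *m (b *: C)) -scalemxAr -scalemxAl scalerA mulrC.
pose G l (t : k) := t ^+ 2 *: Rl l + (t *: (Xl l *m Rl l - Rl l *m Xl l) +
                      - (Xl l *m Rl l *m Xl l)).
have Gp l : polymx (G l).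
  apply: polymxD; first by apply: polymxZ (polymx_cst _); apply/polyfunX/polyfun_id.
  by apply: polymxD (polymx_cst _); apply: polymxZ (polymx_cst _); apply/polyfun_id.
(* The factor [(t ^+ 2) ^+ (n - size u.2)] pads shorter words, so that all words carry the same
   total power of t. *)
pose q t := \sum_(u <- s)
   u.1 * (t ^+ 2) ^+ (n - size u.2) * \tr ((\prod_(l <- u.2) G l t) *m Z).
have qp : polyfun q.
  apply: polyfun_sum => u; apply: polyfunM.
    by apply: polyfunM (polyfun_cst _) _; do 2!apply: polyfunX; apply: polyfun_id.
  by apply/polyfun_mxtrace/polymxM; [apply: polymx_prod|apply: polymx_cst].
have q0 t : t != 0 -> q t = 0.
  move=> t0; pose E i := 1%:M + t^-1 *: X i; pose E' i := 1%:M - t^-1 *: X i.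
  have EE' i : E' i *m E i = 1%:M.
    rewrite mulmxDr mulmx1 mulmxBl mul1mx -scalemxAl -scalemxAr XX !scaler0 subr0.
    by rewrite subrK.
  have E'E i : E i *m E' i = 1%:M.
    rewrite mulmxBr mulmx1 mulmxDl mul1mx -scalemxAl -scalemxAr XX !scaler0 addr0.
    by rewrite addrK.
  pose f i a := E i *m R i a *m E' i.
  have f_lin i : linear (f i).
    move=> c a b; rewrite /f linearP (mulmxDr (E i)) (mulmxDl _ _ (E' i)).
    by rewrite -scalemxAr -scalemxAl.
  have f_mul i : monoid_morphism (f i).
    split=> [|a b]; first by rewrite /f rmorph1 mulmx1.
    have RM : R i (a * b) = R i a *m E' i *m E i *m R i b.
      by rewrite -(mulmxA _ (E' i)) EE' mulmx1; apply: rmorphM.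
    by rewrite /f RM -[RHS]/(E i *m R i a *m E' i *m (E i *m R i b *m E' i)) !mulmxA.
  have [g gE] := free_product_mx hP (fun i => mx_lrmorphism (f_lin i) (f_mul i)) N_gt0.
  have GE l : G l t = t ^+ 2 *: g (eval_letter iota l).
    have -> : g (eval_letter iota l) = Rl l + t^-1 *: (Xl l *m Rl l) -
        (t^-1 *: (Rl l *m Xl l) + (t^-1 * t^-1) *: (Xl l *m Rl l *m Xl l)).
      rewrite gE /= /f /E /E' mulmxBr mulmx1 mulmxDl mul1mx -scalemxAl -scalemxAr.
      by rewrite mulmxDl -scalemxAl scalerDr scalerA.
    rewrite scalerBr !scalerDr !scalerA expr2 -mulrA mulfV // mulr1 mulrA.
    rewrite -(mulrA t) mulfV // mulr1 mulfV // scale1r /G expr2 scalerBr.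
    by rewrite opprD !addrA.
  rewrite -[RHS](mulr0 ((t ^+ 2) ^+ n)) -(rZ g) /eval_sum linear_sum /=.
  rewrite mulmx_suml linear_sum mulr_sumr /q [LHS]big_seq [RHS]big_seq.
  apply: eq_bigr => u us.
  have -> : \prod_(l <- u.2) G l t = (t ^+ 2) ^+ size u.2 *: g (eval_word iota u.2).
    rewrite /eval_word rmorph_prod; elim: (u.2) => [|l w IH].
      by rewrite !big_nil scale1r.
    by rewrite !big_cons IH GE scaleM -exprS.
  rewrite linearZ_LR -!scalemxAl !mxtraceZ mulrA -(mulrA u.1) -exprD.
  rewrite subnK ?(allP sn) // (mulrC u.1) -mulrA; congr (_ * _).
  by rewrite -[RHS]/(\tr _) mxtraceZ.
(* At t = 0 the padding kills all words shorter than n and is 1 on those of length n, where each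
   letter contributes a sign; the outer factor cancels these signs. *)
transitivity ((-1) ^+ n * q 0); last by rewrite (polyfun0 k_pchar qp q0) mulr0.
rewrite /q mulr_sumr.
rewrite [LHS]big_mkcond [LHS]big_seq [RHS]big_seq.
apply: eq_bigr => u us; have [un|un] := eqVneq (size u.2) n; last first.
  have lt0 : (0 < n - size u.2)%N by rewrite subn_gt0 ltn_neqAle un (allP sn).
  by rewrite (expr0n _ 2) expr0n eqn0Ngt lt0 mulr0 mul0r mulr0.
rewrite un subnn mulr1 mulrCA; congr (_ * _).
have -> : \prod_(l <- u.2) G l 0 = (-1) ^+ n *: \prod_(l <- u.2) (Xl l *m Rl l *m Xl l).
  rewrite -un; elim: (u.2) => [|l w IH]; first by rewrite !big_nil scale1r.
  by rewrite !big_cons IH /G expr0n scale0r scale0r !add0r -scaleN1r scaleM -exprS.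
by rewrite -scalemxAl mxtraceZ mulrA -expr2 sqrr_sign mul1r.
Qed.

End Deformation.
End LeadingTerm.

(** * The matrices U, W and R *)

Lemma mul_mxdiag_mxdiag (R : pzRingType) p (p_ : 'I_p -> nat)
    (B D : forall i, 'M[R]_(p_ i)) :
  \mxdiag_i B i *m \mxdiag_i D i = \mxdiag_i (B i *m D i).
Proof.
rewrite {2}/mxdiag mul_mxdiag_mxblock /mxdiag; apply: eq_mxblock => i j.
by case: eqP => [<-|_]; rewrite ?conform_mx_id ?mulmx0.
Qed.

Section DiagonalRep.
Variables (k : fieldType) (C : algType k) (p : nat) (p_ : 'I_p -> nat).
Variable r : forall i, {lrmorphism C -> 'M[k]_(p_ i)}.

Fact diag_rep_linear : linear (fun c => \mxdiag_i r i c).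
Proof.
move=> a b c; rewrite -mul_scalar_mx -mxdiagZ mul_mxdiag_mxdiag -mxdiagD.
by apply: eq_mxdiag => i; rewrite linearP mul_scalar_mx.
Qed.

Fact diag_rep_mul : monoid_morphism (fun c => \mxdiag_i r i c).
Proof.
split=> [|a b].
  by rewrite -[RHS]/(1%:M) -mxdiagZ; apply: eq_mxdiag => i; rewrite rmorph1.
rewrite -[RHS]/(_ *m _) mul_mxdiag_mxdiag.
by apply: eq_mxdiag => i; rewrite rmorphM.
Qed.

Definition diag_rep := mx_lrmorphism diag_rep_linear diag_rep_mul.
End DiagonalRep.

(** [R] is a sum of D / d copies of [r], and [E], [E'] cut out the first block. This brings the
    representations of different algebras to a common size. *)
Lemma rep_multiple (k : fieldType) (C : algType k) d D (r : {lrmorphism C -> 'M[k]_d}) :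
  (0 < D)%N -> (d %| D)%N ->
  exists R : {lrmorphism C -> 'M[k]_D}, exists (E : 'M_(d, D)) (E' : 'M_(D, d)),
    (forall a, E *m R a *m E' = r a) /\
    forall a, \tr (R a) = (D %/ d)%:R * \tr (r a).
Proof.
move=> D_gt0 /dvdnP[q DE]; move: D_gt0; rewrite {}DE muln_gt0 => /andP[q_gt0 d_gt0].
rewrite mulnK //; have qE : (\sum_(i < q) d = q * d)%N.
  by rewrite sum_nat_const card_ord.
(* The size of a block matrix is a sum of block sizes, so q * d is replaced by such a sum first. *)
case: _ / qE; exists (diag_rep (fun _ : 'I_q => r)).
pose i0 := Ordinal q_gt0.
exists (\mxrow_(j < q) (if j == i0 then 1%:M else 0 : 'M[k]_d)).
exists (\mxcol_(j < q) (if j == i0 then 1%:M else 0 : 'M[k]_d)); split=> a /=.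
  rewrite mul_mxrow_mxdiag mul_mxrow_mxcol (bigD1 i0) //= ?eqxx mul1mx mulmx1.
  by rewrite big1 ?addr0 // => j /negPf->; rewrite ?mulmx0 ?mul0mx.
by rewrite mxtrace_mxdiag sumr_const card_ord mulr_natl.
Qed.

Section Inflate.
Variables (k : fieldType) (s : nat).

(** The Kronecker product of [M] with the identity of size [s]. *)
Definition inflate m n (M : 'M[k]_(m, n)) : 'M_(\sum_(i < m) s, \sum_(j < n) s) :=
  \mxblock_(i, j) ((M i j)%:M : 'M[k]_s).

Lemma inflateM m n p (M : 'M[k]_(m, n)) (M' : 'M_(n, p)) :
  inflate M *m inflate M' = inflate (M *m M').
Proof.
rewrite mul_mxblock; apply: eq_mxblock => i j; rewrite mxE raddf_sum.
by apply: eq_bigr => l _; rewrite -scalar_mxM.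
Qed.

Lemma inflate1 n : inflate (1%:M : 'M_n) = 1%:M.
Proof.
rewrite -mxdiagZ /mxdiag; apply: eq_mxblock => i j; rewrite mxE.
by case: eqP => _; rewrite ?conform_mx_id ?raddf0.
Qed.

Variables (C : algType k) (n : nat) (r : {lrmorphism C -> 'M[k]_n}).

Fact inflate_linear : linear (fun c => inflate (r c)).
Proof.
move=> a b c; apply/matrixP => i j; rewrite !mxE linearP !mxE.
by rewrite mulrnDl mulrnAr.
Qed.

Fact inflate_mul : monoid_morphism (fun c => inflate (r c)).
Proof.
split=> [|a b]; first by rewrite rmorph1 inflate1.
by rewrite rmorphM -[RHS]/(_ *m _) inflateM.
Qed.

Definition inflate_rep := mx_lrmorphism inflate_linear inflate_mul.
End Inflate.

Section Packages.
Variables (k : fieldType) (m : nat) (A : 'I_m -> falgType k).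
Local Notation d i := (\dim {:A i}).
Local Notation e i := (vbasis {:A i}).

Definition common_dim := (\prod_(i < m) d i)%N.

Lemma common_dim_gt0 : (0 < common_dim)%N.
Proof. by rewrite prodn_gt0 // => i; apply: dim_falg_gt0. Qed.

Lemma dvdn_common_dim i : (d i %| common_dim)%N.
Proof. by rewrite /common_dim (bigD1 i) //= dvdn_mulr. Qed.

(** There is one block of size [D] for each [l]. The row [w l] lives in block [l], while [u l] is
    zero there and is normalized against [w l'] in every other block [l']; the column [c i q],
    living in block [Some i], reads off a coordinate of a. The extra index [None] differs from all
    [Some i]. *)
Lemma scalar_package : exists K (M : forall i, {lrmorphism A i -> 'M[k]_K})
    (w : option 'I_m -> 'rV[k]_K) (u : option 'I_m -> 'cV[k]_K)
    (c : forall i, 'I_(d i) -> 'cV[k]_K),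
  [/\ (0 < K)%N,
      forall i a, w (Some i) *m M i a *m u (Some i) = 0,
      forall l l', l != l' -> w l *m u l' = 1%:M,
      forall i a q, w (Some i) *m M i a *m c i q = (coord (e i) q a)%:M
    & forall i l q, l != Some i -> w l *m c i q = 0].
Proof.
pose D := common_dim.
have /(_ _)/cid R_ex i :=
  rep_multiple (reg_rep (A i)) common_dim_gt0 (dvdn_common_dim i).
pose R i := projT1 (R_ex i).
(* The regular representation of x sends the coordinates of 1 to those of x; [b] picks one of
   them. *)
have E_ex i : exists (a : 'rV[k]_D) (b : 'I_(d i) -> 'cV[k]_D),
    forall x q, a *m R i x *m b q = (coord (e i) q x)%:M.
  have [E [E' [RE _]]] := projT2 (R_ex i).
  exists (rVof (e i) 1 *m E), (fun q => E' *m delta_mx q 0) => x q.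
  rewrite -(mulmxA _ E) mulmxA -(mulmxA _ (E *m _)) RE rVof_reg_rep mul1r.
  by rewrite -colE [LHS]mx11_scalar !mxE.
have /(_ _)/cid a_ex := E_ex; pose a i := projT1 (a_ex i).
have /(_ _)/cid b_ex i := projT2 (a_ex i); pose b i := projT1 (b_ex i).
have abE i x q : a i *m R i x *m b i q = (coord (e i) q x)%:M.
  exact: projT2 (b_ex i) x q.
have /(_ _)/cid g_ex i : exists g : 'cV[k]_D, a i *m g = 1%:M.
  have : rVof (e i) 1 != 0 by rewrite rVof_eq0 ?oner_eq0 ?vbasis_fullP.
  move=> /rV0Pn[q]; rewrite mxE => q0; exists ((coord (e i) q 1)^-1 *: b i q).
  rewrite -scalemxAr -[a i](mulmx1 (a i)) -[1%:M](rmorph1 (R i)) abE.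
  by rewrite scale_scalar_mx mulVf.
pose i0 : 'I_D := Ordinal common_dim_gt0.
pose al l : 'rV[k]_D := if l is Some i then a i else delta_mx 0 i0.
pose ga l : 'cV[k]_D := if l is Some i then projT1 (g_ex i) else delta_mx i0 0.
have alga l : al l *m ga l = 1%:M.
  case: l => [i|]; first exact: projT2 (g_ex i).
  by rewrite mul_delta_mx [LHS]mx11_scalar mxE !eqxx.
pose L := #|{: option 'I_m}|.
pose w l := \mxrow_(x < L) (if x == enum_rank l then al l else 0 : 'rV[k]_D).
pose u l := \mxcol_(x < L)
  (if x == enum_rank l then 0 else ga (enum_val x) : 'cV[k]_D).
pose c i q := \mxcol_(x < L)
  (if x == enum_rank (Some i) then b i q else 0 : 'cV[k]_D).
have wE (l : option 'I_m) (N : 'M[k]_D) (C : 'I_L -> 'cV[k]_D) :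
    w l *m (\mxdiag_(x < L) N) *m (\mxcol_(x < L) C x) = al l *m N *m C (enum_rank l).
  rewrite mul_mxrow_mxdiag mul_mxrow_mxcol (bigD1 (enum_rank l)) //= eqxx.
  by rewrite big1 ?addr0 // => x /negPf->; rewrite !mul0mx.
have wE1 (l : option 'I_m) (C : 'I_L -> 'cV[k]_D) :
    w l *m (\mxcol_(x < L) C x) = al l *m C (enum_rank l).
  by have := wE l 1%:M C; rewrite mxdiagZ !mulmx1.
exists (\sum_(x < L) D)%N, (fun i => diag_rep (fun _ : 'I_L => R i)), w, u, c.
split.
- rewrite sum_nat_const card_ord muln_gt0 common_dim_gt0 andbT.
  by apply/card_gt0P; exists None.
- by move=> i x; rewrite wE eqxx mulmx0.
- by move=> l l' ll'; rewrite wE1 (inj_eq enum_rank_inj) (negPf ll') enum_rankK alga.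
- by move=> i x q; rewrite wE eqxx abE.
- by move=> i l q li; rewrite wE1 (inj_eq enum_rank_inj) (negPf li) mulmx0.
Qed.

(** Tensoring [scalar_package] with matrices of size [s]: [W l] is [w l] times the identity, and
    [U (Some i)] adds to [u] the columns [c i q] weighted by the values of [F i] on the basis. Only
    these weighted columns survive in W R(a) U, and only [u] in W U for distinct indices. *)
Lemma matrix_package s (F : forall i, {linear A i -> 'M[k]_s}) :
  (0 < s)%N ->
  exists N (R : forall i, {lrmorphism A i -> 'M[k]_N})
    (W : option 'I_m -> 'M[k]_(s, N)) (U : option 'I_m -> 'M[k]_(N, s)),
  [/\ (0 < N)%N,
      forall i a, W (Some i) *m R i a *m U (Some i) = F i a
    & forall l l', l != l' -> W l *m U l' = 1%:M].
Proof.
move=> s_gt0; have [K [M [w [u [c [K_gt0 wMu wu wMc wc]]]]]] := scalar_package.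
pose G l y : 'M[k]_s := if l is Some i then
  \sum_(q < d i) c i q y 0 *: F i (e i)`_q else 0.
pose W l := \mxrow_(x < K) ((w l 0 x)%:M : 'M[k]_s).
pose U l := \mxcol_(y < K) (u l y 0 *: 1%:M + G l y).
have WU (v : 'rV[k]_K) l :
    \mxrow_(x < K) ((v 0 x)%:M : 'M[k]_s) *m U l =
    (v *m u l) 0 0 *: 1%:M +
    (if l is Some i then \sum_(q < d i) (v *m c i q) 0 0 *: F i (e i)`_q else 0).
  rewrite mul_mxrow_mxcol.
  under eq_bigr do rewrite mul_scalar_mx scalerDr scalerA.
  rewrite big_split -scaler_suml /=; congr (_ *: _ + _); first by rewrite mxE.
  case: l => [i|]; last by apply: big1 => y _; rewrite scaler0.
  under eq_bigr do rewrite scaler_sumr.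
  rewrite exchange_big /=; apply: eq_bigr => q _.
  by rewrite mxE scaler_suml; apply: eq_bigr => y _; rewrite scalerA.
exists (\sum_(x < K) s)%N, (fun i => inflate_rep s (M i)), W, U; split.
- by rewrite sum_nat_const card_ord muln_gt0 K_gt0.
- move=> i a.
  have -> : W (Some i) *m inflate_rep s (M i) a =
      \mxrow_(x < K) (((w (Some i) *m M i a) 0 x)%:M : 'M[k]_s).
    rewrite mul_mxrow_mxblock; apply: eq_mxrow => y; rewrite mxE raddf_sum /=.
    by apply: eq_bigr => x _; rewrite -scalar_mxM.
  rewrite WU wMu mxE scale0r add0r [in RHS](coord_vbasis (memvf a)) linear_sum.
  by apply: eq_bigr => q _; rewrite wMc mxE eqxx mulr1n linearZ.
move=> l l' ll'; rewrite WU wu // mxE eqxx scale1r.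
case: l' ll' => [i|] ll'; last by rewrite addr0.
by rewrite big1 ?addr0 // => q _; rewrite wc // mxE scale0r.
Qed.

End Packages.

Lemma mxtrace_mul_delta (k : fieldType) n (Q : 'M[k]_n) a b :
  \tr (Q *m delta_mx b a) = Q a b.
Proof.
rewrite mxtrace_mulC /mxtrace (bigD1 b) //= big1 => [|i /negPf ib].
  rewrite addr0 mxE (bigD1 a) //= big1 => [|j /negPf ja]; rewrite mxE eqxx.
    by rewrite eqxx mul1r addr0.
  by rewrite ja mul0r.
by rewrite mxE big1 // => j _; rewrite mxE ib mul0r.
Qed.

(** * Alternating words and their leading terms *)

Section AlternatingProducts.
Variables (k : fieldType) (m : nat) (A : 'I_m -> falgType k).
Local Notation letter := {i : 'I_m & A i}.

Definition alternating (w : seq letter) :=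
  sorted (fun x y => tag x != tag y) w.

Definition cyclically_alternating (w : seq letter) :=
  cycle (fun x y => tag x != tag y) w.

Lemma cyclically_alternatingE (l : letter) w :
  cyclically_alternating (l :: w) =
  alternating (l :: w) && (tag (last l w) != tag l).
Proof. by rewrite /cyclically_alternating /= rcons_path. Qed.

Variables (s N : nat) (F : forall i, {linear A i -> 'M[k]_s}).
Variables (R : forall i, {lrmorphism A i -> 'M[k]_N}).
Variables (W : option 'I_m -> 'M[k]_(s, N)) (U : option 'I_m -> 'M[k]_(N, s)).
Hypotheses (F1 : forall i, F i 1 = 0)
  (WRU : forall i a, W (Some i) *m R i a *m U (Some i) = F i a)
  (WU1 : forall l l', l != l' -> W l *m U l' = 1%:M).

Definition letter_mx (l : letter) : 'M[k]_s := F (tag l) (tagged l).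

Let X i : 'M[k]_N := U (Some i) *m W (Some i).

(** For i = j this is W R(1) U = F 1 = 0, which is why the forms [F] must vanish at 1. *)
Lemma package_mul i j : W (Some i) *m U (Some j) = (i != j)%:R%:M.
Proof.
have [<-|ij] := eqVneq i j; last by rewrite WU1 // (inj_eq Some_inj).
by have := WRU (1 : A i); rewrite rmorph1 mulmx1 F1 raddf0.
Qed.

Lemma package_sq i : X i *m X i = 0.
Proof.
by rewrite /X mulmxA -(mulmxA (U _)) package_mul eqxx raddf0 mulmx0 mul0mx.
Qed.

Lemma package_prod (l : letter) w :
  \prod_(x <- l :: w) (X (tag x) *m R (tag x) (tagged x) *m X (tag x)) =
  (alternating (l :: w))%:R *: (U (Some (tag l)) *m
    (\prod_(x <- l :: w) letter_mx x) *m W (Some (tag (last l w)))).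
Proof.
have XE x : X (tag x) *m R (tag x) (tagged x) *m X (tag x) =
    U (Some (tag x)) *m letter_mx x *m W (Some (tag x)).
  by rewrite /letter_mx -WRU /X !mulmxA.
elim: w l => [|l' w IH] l; first by rewrite !big_seq1 scale1r XE.
rewrite big_cons IH XE [in RHS]big_cons.
set Q := \prod_(j <- _) letter_mx j.
rewrite -[LHS]/(_ *m _) -[letter_mx l * Q]/(letter_mx l *m Q) -scalemxAr.
rewrite !mulmxA -(mulmxA _ (W _)) package_mul mul_mx_scalar -!scalemxAl scalerA.
by rewrite /= -natrM mulnb andbC.
Qed.

End AlternatingProducts.

Section Vanishing.
Variables (k : fieldType) (k_pchar : [pchar k] =i pred0).
Variables (m : nat) (A : 'I_m -> falgType k) (P : algType k).
Variable iota : forall i, {lrmorphism A i -> P}.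
Hypothesis hP : @is_free_product k 'I_m (fun i => A i) P iota.
Local Notation letter := {i : 'I_m & A i}.

Variables (n q : nat) (F : forall i, {linear A i -> 'M[k]_q.+1}).
Hypothesis F1 : forall i, F i 1 = 0.
Variable s : seq (k * seq letter).
Hypothesis s_le : all (fun t => size t.2 <= n.+1)%N s.

Lemma lead_vanish :
  (forall N (r : {lrmorphism P -> 'M[k]_N}), r (eval_sum iota s) = 0) ->
  \sum_(t <- s | (size t.2 == n.+1) && alternating t.2)
    t.1 *: \prod_(x <- t.2) letter_mx F x = 0.
Proof.
move=> r0; have [N [R [W [U [N_gt0 WRU WU1]]]]] := matrix_package F (ltn0Sn q).
pose X i := U (Some i) *m W (Some i).
have XX i : X i *m X i = 0 := package_sq F1 WRU WU1 i.
apply/matrixP => a b; rewrite summxE mxE.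
(* The index [None] differs from those of the outer letters, so [Z] cancels the outer [U] and [W]
   and the trace extracts the entry (a, b). *)
pose Z := U None *m delta_mx b a *m W None.
apply: etrans (deformation_lead k_pchar hP R (Z := Z) N_gt0 XX s_le _); last first.
  by move=> r; rewrite r0 mul0mx mxtrace0.
rewrite [LHS]big_mkcond [RHS]big_mkcond; apply: eq_bigr => -[c [|l w]] _.
  by [].
have [_|//] := eqVneq (size _) n.+1; rewrite (package_prod F1 WRU WU1).
case: (alternating _); last by rewrite /= scale0r mul0mx mxtrace0 mulr0.
rewrite scale1r mxE /=; congr (_ * _); set Q := \prod_(x <- _) _.
rewrite !mulmxA -(mulmxA _ (W _)) WU1 // mulmx1 mxtrace_mulC.
by rewrite !mulmxA WU1 // mul1mx mxtrace_mul_delta.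
Qed.

(** With [Z = 1%:M], closing up the trace brings the last [W] against the first [U], which selects
    the cyclically alternating words. One-letter words are never among them. *)
Lemma trace_vanish :
  (forall N (r : {lrmorphism P -> 'M[k]_N}), \tr (r (eval_sum iota s)) = 0) ->
  \sum_(t <- s | (size t.2 == n.+1) && cyclically_alternating t.2)
    t.1 * \tr (\prod_(x <- t.2) letter_mx F x) = 0.
Proof.
move=> r0; have [N [R [W [U [N_gt0 WRU WU1]]]]] := matrix_package F (ltn0Sn q).
pose X i := U (Some i) *m W (Some i).
have XX i : X i *m X i = 0 := package_sq F1 WRU WU1 i.
apply: etrans (deformation_lead k_pchar hP R (Z := 1%:M) N_gt0 XX s_le _); last first.
  by move=> r; rewrite mulmx1.
rewrite [LHS]big_mkcond [RHS]big_mkcond; apply: eq_bigr => -[c [|l w]] _.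
  by [].
have [_|//] := eqVneq (size _) n.+1; rewrite (package_prod F1 WRU WU1) mulmx1.
rewrite cyclically_alternatingE.
case: (alternating _); last by rewrite /= scale0r mxtrace0 mulr0.
rewrite scale1r /= -mulmxA mxtrace_mulC -mulmxA (package_mul F1 WRU WU1).
by case: eqP => _; rewrite ?mulmx1 // raddf0 mulmx0 mxtrace0 mulr0.
Qed.
End Vanishing.

(** * Cyclic matrices and descent on word length *)

Section CyclicMatrices.
Variables (k : fieldType) (T : Type) (n : nat).

Fixpoint weight (f : nat -> T -> k) (w : seq T) : k :=
  if w is x :: w' then f 0%N x * weight (fun j => f j.+1) w' else 1.

Fixpoint cyclic_weight (f : nat -> T -> k) (b : 'I_n.+1) (w : seq T) : k :=
  if w is x :: w' then f b x * cyclic_weight f (ordS b) w' else 1.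

Definition cyclic_mx (f : nat -> T -> k) (x : T) : 'M[k]_n.+1 :=
  \matrix_(b, c) (f b x *+ (c == ordS b)).

(** Each row of [cyclic_mx] is supported on one entry, so a single path of given length leaves
    [b]. *)
Lemma cyclic_mx_prod f w b c :
  (\prod_(x <- w) cyclic_mx f x) b c =
  cyclic_weight f b w *+ (c == iter (size w) (@ordS n.+1) b).
Proof.
elim: w b => [|x w IH] b; first by rewrite big_nil mxE eq_sym.
rewrite big_cons.
transitivity ((cyclic_mx f x *m \prod_(y <- w) cyclic_mx f y) b c) => //.
rewrite mxE (bigD1 (ordS b)) //= [X in _ + X = _]big1 => [|d /negPf db].
  by rewrite addr0 mxE eqxx mulr1n IH mulrnAr -iterS iterSr.
by rewrite mxE db mulr0n mul0r.
Qed.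

Lemma val_iter_ordS j (b : 'I_n.+1) :
  iter j (@ordS n.+1) b = ((b + j) %% n.+1)%N :> nat.
Proof.
elim: j => [|j IH]; first by rewrite addn0 modn_small.
by rewrite iterS /= IH -addn1 modnDml addn1 addnS.
Qed.

Lemma cyclic_weight_cat f b u v : cyclic_weight f b (u ++ v) =
  cyclic_weight f b u * cyclic_weight f (iter (size u) (@ordS n.+1) b) v.
Proof.
elim: u b => [|x u IH] b /=; first by rewrite mul1r.
by rewrite IH -iterS iterSr mulrA.
Qed.

Lemma cyclic_weight_weight f (b : 'I_n.+1) w : (b + size w <= n.+1)%N ->
  cyclic_weight f b w = weight (fun j => f (b + j)%N) w.
Proof.
elim: w b => //= x [|y w] IH b bw; first by rewrite addn0.
have bE : ordS b = b.+1 :> nat.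
  by rewrite /= modn_small // (leq_trans _ bw) //= !addnS !ltnS leq_addr.
rewrite IH ?bE ?addSnnS // addn0; congr (_ * weight _ _).
by apply/funext => j; rewrite addSnnS.
Qed.

(** Starting from [b], the index returns to 0 after [n.+1 - b] letters; the rotation makes the word
    start there. *)
Lemma cyclic_weight_rot f (b : 'I_n.+1) w : size w = n.+1 ->
  cyclic_weight f b w = weight f (rot (n.+1 - b) w).
Proof.
move=> sw.
have -> : weight f (rot (n.+1 - b) w) =
    cyclic_weight f ord0 (rot (n.+1 - b) w).
  by rewrite cyclic_weight_weight ?size_rot ?sw //; congr weight; apply/funext.
rewrite /rot -{1}(cat_take_drop (n.+1 - b) w) !cyclic_weight_cat mulrC.
have st : size (take (n.+1 - b) w) = (n.+1 - b)%N.
  by rewrite size_takel // sw leq_subr.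
have sd : size (drop (n.+1 - b) w) = b.
  by rewrite size_drop sw subKn // ltnW.
rewrite st sd; congr (cyclic_weight _ _ _ * cyclic_weight _ _ _); apply: val_inj.
  by rewrite /= val_iter_ordS subnKC ?modnn // ltnW.
by rewrite /= val_iter_ordS add0n modn_small.
Qed.

Lemma mxtrace_cyclic f w : size w = n.+1 ->
  \tr (\prod_(x <- w) cyclic_mx f x) =
  \sum_(b < n.+1) weight f (rot (n.+1 - b) w).
Proof.
move=> sw; apply: eq_bigr => b _; rewrite cyclic_mx_prod cyclic_weight_rot // sw.
have -> : iter n.+1 (@ordS n.+1) b = b.
  by apply: ord_inj; rewrite val_iter_ordS modnDr modn_small.
by rewrite eqxx.
Qed.

Lemma cyclic_mx00 f w : size w = n.+1 ->
  (\prod_(x <- w) cyclic_mx f x) ord0 ord0 = weight f w.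
Proof.
move=> sw; rewrite cyclic_mx_prod cyclic_weight_rot // subn0.
have -> : rot n.+1 w = w by rewrite -sw rot_size.
have -> : iter (size w) (@ordS n.+1) ord0 = ord0.
  by apply: ord_inj; rewrite val_iter_ordS sw add0n modnn.
by rewrite eqxx.
Qed.
End CyclicMatrices.

(** * Reduced letters and polarization *)

Section Reduction.
Variables (k : fieldType) (m : nat) (A : 'I_m -> falgType k).
Local Notation letter := {i : 'I_m & A i}.
Local Notation d i := (\dim {:A i}).
Local Notation e i := (vbasis {:A i}).

Fact augmentation_subproof i : {q : 'I_(d i) | coord (e i) q 1 != 0}.
Proof.
apply: sigW.
have : rVof (e i) 1 != 0 by rewrite rVof_eq0 ?oner_eq0 ?vbasis_fullP.
by move=> /rV0Pn[q]; rewrite mxE; exists q.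
Qed.

(** Only a linear form with value 1 at 1, not a character: a normalized coordinate that does not
    vanish at 1. *)
Definition augmentation i (a : A i) : k :=
  (coord (e i) (sval (augmentation_subproof i)) 1)^-1 *
  coord (e i) (sval (augmentation_subproof i)) a.

Lemma augmentation1 i : augmentation (1 : A i) = 1.
Proof.
by rewrite /augmentation mulVf //; apply: (svalP (augmentation_subproof i)).
Qed.

Lemma augmentation_scalar i : scalar (@augmentation i).
Proof. by move=> c a b; rewrite /augmentation linearP /= mulrDr mulrCA. Qed.

Definition reduced i (a : A i) : A i := a - augmentation a *: 1.

Lemma reduced1 i : reduced (1 : A i) = 0.
Proof. by rewrite /reduced augmentation1 scale1r subrr. Qed.

Lemma reduced_linear i : linear (@reduced i).
Proof.
move=> c a b; rewrite /reduced augmentation_scalar scalerDl scalerBr scalerA.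
by rewrite opprD addrACA.
Qed.

Definition admissible (f : letter -> k) :=
  (forall i, scalar (fun a : A i => f (Tagged (fun i => A i) a))) /\
  (forall i, f (Tagged (fun i => A i) (1 : A i)) = 0).

(** The range of coordinates depends on the letter, so [p] is a natural number and the value is 0
    out of range. *)
Definition coord_form (j : 'I_m) (p : nat) (l : letter) : k :=
  if tag l == j then
    (if insub p is Some q then coord (e (tag l)) q (reduced (tagged l)) else 0)
  else 0.

Lemma coord_form_admissible j p : admissible (coord_form j p).
Proof.
split=> i; rewrite /coord_form /=; last first.
  by case: eqP => // _; case: insubP => // q _ _; rewrite reduced1 linear0.
move=> c a b; case: eqP => _; last by rewrite mulr0 addr0.
by case: insubP => [q _ _|_]; rewrite ?reduced_linear ?linearP // mulr0 addr0.
Qed.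

Fact admissible_mx n f : (forall j : nat, admissible (f j)) ->
  {F : forall i, {linear A i -> 'M[k]_n.+1} |
    (forall i, F i 1 = 0) /\ forall l, letter_mx F l = cyclic_mx n f l}.
Proof.
move=> fa; pose F i (a : A i) := cyclic_mx n f (Tagged (fun i => A i) a).
have F_lin i : linear (@F i).
  move=> c a b; apply/matrixP => x y; rewrite !mxE (proj1 (fa x)).
  by rewrite mulrnDl mulrnAr.
pose FL i : {linear A i -> 'M[k]_n.+1} := HB.pack (@F i)
  (GRing.isSemilinear.Build k (A i) 'M[k]_n.+1 *:%R (@F i)
    (GRing.semilinear_linear (F_lin i))).
exists FL; split=> [i|[i a]] //; apply/matrixP => x y.
by rewrite !mxE (proj2 (fa x)) mul0rn.
Qed.

Variables (P : algType k) (iota : forall i, {lrmorphism A i -> P}).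

Definition eval_reduced (w : seq letter) : P :=
  \prod_(l <- w) iota (tag l) (reduced (tagged l)).

Lemma reduced_expand (l : letter) : iota (tag l) (reduced (tagged l)) =
  \sum_(j < m) \sum_(p < d j) coord_form j p l *: iota j (e j)`_p.
Proof.
rewrite (bigD1 (tag l)) //= [X in _ + X]big1 => [|j jl]; last first.
  by rewrite big1 // => p _; rewrite /coord_form eq_sym (negPf jl) scale0r.
rewrite addr0 [in LHS](coord_vbasis (memvf (reduced _))) linear_sum.
apply: eq_bigr => p _; rewrite linearZ /coord_form eqxx.
by rewrite insubT //= => lt; congr (coord _ _ _ *: _); apply: val_inj.
Qed.

(* One letter at a time, each linear form is replaced by the reduced letter
   itself, expanded in the basis of its algebra. *)
Lemma weight_polarize n (S : seq (P * seq letter)) :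
  all (fun t => size t.2 == n) S ->
  (forall f, (forall j, admissible (f j)) ->
     \sum_(t <- S) weight f t.2 *: t.1 = 0) ->
  \sum_(t <- S) t.1 * eval_reduced t.2 = 0.
Proof.
elim: n S => [|n IH] S Sn S0.
  have f0 (j : nat) : admissible (fun=> 0) by split=> // i c a b; rewrite mulr0 addr0.
  rewrite -[RHS](S0 _ f0) big_seq [RHS]big_seq; apply: eq_bigr => -[x [|l w]] tS.
    by rewrite /eval_reduced big_nil mulr1 scale1r.
  by have := allP Sn _ tS.
(* The coefficients lie in [P], so they can absorb the first reduced letter. *)
pose g (t : P * seq letter) := if t.2 is l :: w
  then (t.1 * iota (tag l) (reduced (tagged l)), w) else t.
transitivity (\sum_(t <- map g S) t.1 * eval_reduced t.2).
  rewrite big_map; apply: eq_bigr => -[x [|l w]] _ //=.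
  by rewrite /eval_reduced big_cons mulrA.
apply: IH => [|f fa].
  rewrite all_map; apply: sub_all Sn => -[x [|l w]] //=.
rewrite big_map.
transitivity (\sum_(j < m) \sum_(p < d j) (\sum_(t <- S)
    weight (fun i => if i is i'.+1 then f i' else coord_form j p) t.2 *: t.1) *
    iota j (e j)`_p); last first.
  rewrite big1 // => j _; rewrite big1 // => p _; rewrite S0 ?mul0r //.
  by case=> [|i]; [apply: coord_form_admissible|apply: fa].
under [RHS]eq_bigr do under eq_bigr do rewrite mulr_suml.
under [RHS]eq_bigr do rewrite exchange_big.
rewrite exchange_big big_seq [RHS]big_seq; apply: eq_bigr => -[x [|l w]] tS /=.
  by have := allP Sn _ tS.
rewrite reduced_expand mulr_sumr scaler_sumr; apply: eq_bigr => j _.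
rewrite mulr_sumr scaler_sumr; apply: eq_bigr => p _.
by rewrite -scalerAr -scalerAl !scalerA mulrC.
Qed.

End Reduction.

(** * Shortening the words of an element on which representations or traces vanish *)

Section Descent.
Variables (k : fieldType) (k_pchar : [pchar k] =i pred0).
Variables (m : nat) (A : 'I_m -> falgType k) (P : algType k).
Variable iota : forall i, {lrmorphism A i -> P}.
Hypothesis hP : @is_free_product k 'I_m (fun i => A i) P iota.
Local Notation letter := {i : 'I_m & A i}.
Local Notation eval_letter := (eval_letter iota).
Local Notation eval_word := (eval_word iota).
Local Notation eval_reduced := (eval_reduced iota).
Local Notation words_le := (words_le iota).

Lemma words_le_merge (x y : letter) :
  tag x = tag y -> words_le 1 (eval_letter x * eval_letter y).
Proof.
case: x y => [i a] [j b] /= ij; case: _ / ij b => b.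
have -> : eval_letter (Tagged (fun i : 'I_m => A i) a) *
      eval_letter (Tagged (fun i : 'I_m => A i) b) =
    eval_letter (Tagged (fun i : 'I_m => A i) (a * b)).
  by rewrite /eval_letter rmorphM.
exact: words_le_letter.
Qed.

Lemma eval_letter_sub_reduced (l : letter) :
  eval_letter l - iota (tag l) (reduced (tagged l)) = augmentation (tagged l) *: 1.
Proof.
rewrite /reduced /eval_letter rmorphB opprB addrC subrK.
by rewrite -[X in _ = _ *: X](rmorph1 (iota (tag l))); apply: linearZ_LR.
Qed.

(** Reducing a letter changes it by a scalar, which shortens the word; the difference telescopes
    over the letters. *)
Lemma words_le_sub_reduced l w :
  words_le (size w) (eval_word (l :: w) - eval_reduced (l :: w)).
Proof.
elim: w l => [|l' w IH] l;
  rewrite /eval_word /eval_reduced big_cons [X in _ - X]big_cons.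
  rewrite !big_nil !mulr1 eval_letter_sub_reduced; exact: words_le_scalar.
rewrite -/(eval_word (l' :: w)) -/(eval_reduced (l' :: w)).
set x := eval_word _; set y := eval_reduced _; set r := iota _ _.
have -> : eval_letter l * x - r * y = (eval_letter l - r) * x + r * (x - y).
  by rewrite mulrBl mulrBr addrA subrK.
apply: words_leD; last first.
  rewrite -[size _]add1n; apply: words_leM (IH l').
  exact: (words_le_letter iota (Tagged (fun i : 'I_m => A i) (reduced (tagged l)))).
rewrite -[size _]add0n; apply: words_leM (words_le_word _ _).
rewrite eval_letter_sub_reduced; exact: words_le_scalar.
Qed.

Lemma words_le_nonalternating l w :
  ~~ alternating (l :: w) -> words_le (size w) (eval_word (l :: w)).
Proof.
elim: w l => [|l' w IH] l //; rewrite /alternating /= negb_and negbK.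
rewrite /eval_word !big_cons => /orP[/eqP ll'|aw].
  rewrite mulrA -[(size w).+1]add1n.
  exact: words_leM (words_le_merge ll') (words_le_word _ _).
rewrite -[(size w).+1]add1n; apply: words_leM (words_le_letter _ _) _.
by have := IH l' aw; rewrite /eval_word big_cons.
Qed.

(** The entry at (0, 0) of a product of [n.+1] cyclic matrices is the [weight] for arbitrary
    admissible forms, and [weight_polarize] turns these scalar identities into one in [P]. *)
Lemma lead_reduced n (s : seq (k * seq letter)) :
  all (fun t => size t.2 <= n.+1)%N s ->
  (forall N (r : {lrmorphism P -> 'M[k]_N}), r (eval_sum iota s) = 0) ->
  \sum_(t <- s | (size t.2 == n.+1) && alternating t.2)
    t.1 *: eval_reduced t.2 = 0.
Proof.
move=> sn r0; pose Q (t : k * seq letter) := (size t.2 == n.+1) && alternating t.2.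
pose S : seq (P * seq letter) := [seq (t.1 *: 1, t.2) | t <- s & Q t].
rewrite -[RHS](@weight_polarize k m A P iota n.+1 S).
- by rewrite big_map big_filter; apply: eq_bigr => t _; rewrite -scalerAl mul1r.
- by rewrite all_map all_filter; apply/allP => t _; apply/implyP => /andP[].
move=> f fa; have [F [F1 FE]] := admissible_mx n fa.
rewrite big_map big_filter.
have /matrixP/(_ ord0 ord0) := lead_vanish k_pchar hP F1 sn r0.
rewrite summxE mxE => h; rewrite -[RHS](scale0r 1) -h scaler_suml.
apply: eq_bigr => t /andP[/eqP st _]; rewrite mxE (eq_bigr _ (fun l _ => FE l)).
by rewrite cyclic_mx00 // scalerA mulrC.
Qed.

Lemma eval_reduced_rot j w :
  eval_reduced (rot j w) - eval_reduced w \in comm_span P.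
Proof.
rewrite -{2}(cat_take_drop j w) /rot /eval_reduced !big_cat.
exact: comm_span_comm.
Qed.

(** The trace of cyclic matrices sums the weights of all rotations of a word. Rotations agree modulo
    commutators, so polarization yields n + 1 times the sum [y], and n + 1 is invertible. *)
Lemma trace_reduced n (s : seq (k * seq letter)) :
  all (fun t => size t.2 <= n.+1)%N s ->
  (forall N (r : {lrmorphism P -> 'M[k]_N}), \tr (r (eval_sum iota s)) = 0) ->
  \sum_(t <- s | (size t.2 == n.+1) && cyclically_alternating t.2)
    t.1 *: eval_reduced t.2 \in comm_span P.
Proof.
move=> sn r0; pose Q (t : k * seq letter) :=
  (size t.2 == n.+1) && cyclically_alternating t.2.
set y := \sum_(t <- s | _) _.
pose S : seq (P * seq letter) :=
  [seq (t.1 *: 1, rot (n.+1 - b) t.2)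
    | t <- [seq t <- s | Q t], b : 'I_n.+1 <- enum 'I_n.+1].
have : \sum_(u <- S) u.1 * eval_reduced u.2 = 0.
  apply: (@weight_polarize k m A P iota n.+1).
    apply/allP => _ /allpairsP[[t b] [/= + _ ->]] /=.
    by rewrite mem_filter size_rot => /andP[/andP[]].
  move=> f fa; have [F [F1 FE]] := admissible_mx n fa.
  rewrite big_allpairs_dep big_filter.
  have h := trace_vanish k_pchar hP F1 sn r0.
  rewrite -[RHS](scale0r 1) -h scaler_suml; apply: eq_bigr => t /andP[/eqP st _].
  rewrite (eq_bigr _ (fun l _ => FE l)) mxtrace_cyclic // mulr_sumr scaler_suml.
  by rewrite big_enum; apply: eq_bigr => b _; rewrite scalerA mulrC.
rewrite big_allpairs_dep big_filter => S0.
have : n.+1%:R *: y \in comm_span P.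
  rewrite -[_ *: y]subr0 -[X in _ - X]S0 /y scaler_sumr -sumrB rpred_sum // => t _.
  rewrite scaler_nat -[X in _ *+ X](card_ord n.+1) -sumr_const big_enum -sumrB.
  rewrite rpred_sum // => b _; rewrite -scalerAl mul1r -scalerBr.
  by apply: comm_span_scale; rewrite -opprB rpredN eval_reduced_rot.
move=> /(comm_span_scale n.+1%:R^-1).
by rewrite scalerA mulVf ?scale1r // natr_pchar0_eq0.
Qed.

(** Since the reduced alternating words of top length cancel, subtracting them is free and leaves
    shorter words; the other top words shorten by merging neighbours. *)
Lemma words_le_descent n x : words_le n.+1 x ->
  (forall N (r : {lrmorphism P -> 'M[k]_N}), r x = 0) -> words_le n x.
Proof.
move=> [s -> /allP sn] r0; have L0 := lead_reduced (introT allP sn) r0.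
pose Q (t : k * seq letter) := (size t.2 == n.+1) && alternating t.2.
have -> : eval_sum iota s = \sum_(t <- s | Q t) t.1 *: eval_word t.2 +
    \sum_(t <- s | (t \in s) && ~~ Q t) t.1 *: eval_word t.2.
  by rewrite -big_seq_cond /eval_sum (bigID Q).
apply: words_leD.
  suff -> : \sum_(t <- s | Q t) t.1 *: eval_word t.2 =
      \sum_(t <- s | Q t) (t.1 *: eval_word t.2 - t.1 *: eval_reduced t.2).
    apply: words_le_sum => -[c w] /= /andP[/eqP sw _].
    rewrite -scalerBr; apply: words_leZ.
    by case: w sw => // l w [<-]; apply: words_le_sub_reduced.
  by rewrite sumrB [X in _ - X]L0 subr0.
apply: words_le_sum => -[c w] /andP[/sn /= sw]; rewrite /Q /=.
have [{}sw|sw' _] := eqVneq (size w) n.+1; last first.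
  apply/words_leZ; apply: words_leW (words_le_word _ _).
  by rewrite -ltnS ltn_neqAle sw'.
case: w sw => // l w [sw] aw; apply: words_leZ; rewrite -sw.
exact: words_le_nonalternating.
Qed.

Definition words_le_mod n x := exists2 y, y \in comm_span P & words_le n (x - y).

(** The descent stops at length 1, because merging the last letter with the first takes at least two
    letters. *)
Lemma words_le_trace_descent n x : words_le n.+2 x ->
  (forall N (r : {lrmorphism P -> 'M[k]_N}), \tr (r x) = 0) -> words_le_mod n.+1 x.
Proof.
move=> [s -> /allP sn] r0; have lead := trace_reduced (introT allP sn) r0.
rewrite /eval_sum big_seq
  (bigID (fun t => (size t.2 == n.+2) && cyclically_alternating t.2)) /=.
have modD x1 x2 : words_le_mod n.+1 x1 -> words_le_mod n.+1 x2 ->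
    words_le_mod n.+1 (x1 + x2).
  move=> [y1 y1c xy1] [y2 y2c xy2]; exists (y1 + y2); first exact: rpredD.
  by rewrite opprD addrACA; apply: words_leD.
apply: (modD).
  exists (\sum_(t <- s | (t \in s) && ((size t.2 == n.+2) &&
    cyclically_alternating t.2)) t.1 *: eval_reduced t.2).
    by rewrite -big_seq_cond.
  rewrite -sumrB; apply: words_le_sum => -[c w] /= /and3P[_ /eqP sw _].
  rewrite -scalerBr; apply: words_leZ.
  by case: w sw => // l w [<-]; apply: words_le_sub_reduced.
apply: (big_ind (words_le_mod n.+1)); [|exact: modD|].
  by exists 0; rewrite ?rpred0 // subr0; apply: words_le0.
move=> [c w] /= /andP[/sn /= sw]; rewrite negb_and.
suff: ~~ ((size w == n.+2) && cyclically_alternating w) ->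
    words_le_mod n.+1 (eval_word w).
  rewrite negb_and => /[apply] -[y yc wy]; exists (c *: y); first exact: comm_span_scale.
  by rewrite -scalerBr; apply: words_leZ.
have [{}sw|sw'] := eqVneq (size w) n.+2; last first.
  exists 0; rewrite ?rpred0 // subr0; apply: words_leW (words_le_word _ _).
  by rewrite -ltnS ltn_neqAle sw'.
case: w sw => // l w [sw]; rewrite andTb cyclically_alternatingE negb_and => /orP[aw|].
  by exists 0; rewrite ?rpred0 // subr0 -sw; apply: words_le_nonalternating.
case/lastP: w sw => // w l'; rewrite size_rcons last_rcons negbK => -[sw] /eqP ll'.
(* Modulo a commutator the last letter moves to the front, where it merges with the first. *)
exists (eval_word (l :: rcons w l') - eval_letter l' * eval_word (l :: w)).
  rewrite /eval_word -cats1 !big_cons big_cat big_seq1 /= [X in X - _]mulrA.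
  exact: comm_span_comm.
rewrite opprB addrC subrK /eval_word big_cons mulrA -sw -[(size w).+1]add1n.
exact: words_leM (words_le_merge ll') (words_le_word _ _).
Qed.

End Descent.

(** * Representations of the free product with prescribed restrictions *)

Section CommonReps.
Variables (k : fieldType) (m : nat) (A : 'I_m -> falgType k) (P : algType k).
Variable iota : forall i, {lrmorphism A i -> P}.
Hypothesis hP : @is_free_product k 'I_m (fun i => A i) P iota.

Lemma common_rep (rho : forall i, {n & {lrmorphism A i -> 'M[k]_n}}) :
  (forall i, 0 < tag (rho i))%N ->
  exists (D : nat) (g : {lrmorphism P -> 'M[k]_D}), (0 < D)%N /\
    forall i, (tag (rho i) %| D)%N /\
      forall a, \tr (g (iota i a)) = (D %/ tag (rho i))%:R * \tr (tagged (rho i) a).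
Proof.
move=> n_gt0; pose D := (\prod_(i < m) tag (rho i))%N.
have D_gt0 : (0 < D)%N by rewrite prodn_gt0.
have nD i : (tag (rho i) %| D)%N by rewrite /D (bigD1 i) //= dvdn_mulr.
have /(_ _)/cid R_ex i := rep_multiple (tagged (rho i)) D_gt0 (nD i).
have [g gE] := free_product_mx hP (fun i => projT1 (R_ex i)) D_gt0.
exists D, g; split=> // i; split=> // a; rewrite gE.
by have [E [E' [_ ->]]] := projT2 (R_ex i).
Qed.

Lemma free_product_rep_exists :
  exists n, inhabited {lrmorphism P -> 'M[k]_n.+1}.
Proof.
have [i|D [g [D_gt0 _]]] := @common_rep (fun i => Tagged _ (reg_rep (A i))).
  exact: dim_falg_gt0.
by case: D D_gt0 g => // D _ g; exists D.
Qed.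

Hypothesis k_pchar : [pchar k] =i pred0.

(** Descent reaches words of length 0, that is, scalars, and a nonzero scalar acts nontrivially in
    any representation of positive size. *)
Lemma free_product_faithful x :
  (forall N (r : {lrmorphism P -> 'M[k]_N}), r x = 0) -> x = 0.
Proof.
move=> r0; have [n] := words_le_ex hP x.
elim: n => [|n IH xn]; last exact/IH/(words_le_descent k_pchar hP).
move=> [s xE /allP s0]; have {xE} [c xE] : exists c, x = c *: 1.
  exists (\sum_(t <- s) t.1); rewrite xE scaler_suml /eval_sum big_seq [RHS]big_seq.
  apply: eq_bigr => -[c w] /s0 /=; rewrite leqn0 => /nilP->.
  by rewrite /eval_word big_nil.
have [D [g]] := free_product_rep_exists; have := r0 _ g.
rewrite xE linearZ /= rmorph1 => /matrixP/(_ ord0 ord0).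
by rewrite !mxE mulr1 => ->; rewrite scale0r.
Qed.

Lemma traceless_degree1 x :
  (forall N (r : {lrmorphism P -> 'M[k]_N}), \tr (r x) = 0) ->
  exists2 y, y \in comm_span P & words_le iota 1 (x - y).
Proof.
move=> r0; have [n] := words_le_ex hP x.
elim: n x r0 => [|[|n] IH] x r0 xn.
- by exists 0; rewrite ?rpred0 // subr0; apply: words_leW xn.
- by exists 0; rewrite ?rpred0 // subr0.
have [y yc xy] := words_le_trace_descent k_pchar hP xn r0.
have [N r|z zc xyz] := IH (x - y) _ xy.
  by rewrite !raddfB /= r0 (mx_rep_trace_comm_span r yc) subrr.
by exists (y + z); rewrite ?rpredD // opprD addrA.
Qed.

Lemma words_le1 x : (0 < m)%N -> words_le iota 1 x ->
  exists a : forall i, A i, x = \sum_i iota i (a i).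
Proof.
move=> m_gt0 [s -> /allP s1]; rewrite /eval_sum big_seq.
have single i (b : A i) : exists a : forall i, A i, iota i b = \sum_i iota i (a i).
  exists (dfwith (fun j => 0 : A j) i b); rewrite (bigD1 i) //= dfwithin.
  by rewrite big1 ?addr0 // => j ji; rewrite dfwithout 1?eq_sym // rmorph0.
apply: (big_ind (fun y => exists a : forall i, A i, y = \sum_i iota i (a i))).
- by exists (fun=> 0); rewrite big1 // => i _; rewrite rmorph0.
- move=> _ _ [a ->] [b ->]; exists (fun i => a i + b i).
  by rewrite -big_split; apply: eq_bigr => i _; rewrite rmorphD.
move=> [c [|l [|l' w]]] /s1 //= _; rewrite /eval_word.
  (* The empty word is the unit, which is placed in the first algebra; this takes [0 < m]. *)
  rewrite big_nil -(rmorph1 (iota (Ordinal m_gt0))) -linearZ_LR; exact: single.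
rewrite big_seq1 /eval_letter -linearZ_LR; exact: single.
Qed.

(** For every choice of representations of the [A i], the normalized traces of the [a i] sum to
    zero. Varying one representation at a time shows that each normalized trace is a constant
    [c i]. *)
Lemma traceless_letters (a : forall i, A i) :
  (forall N (r : {lrmorphism P -> 'M[k]_N}), \tr (r (\sum_i iota i (a i))) = 0) ->
  exists c : 'I_m -> k, \sum_i c i = 0 /\
    forall i n (r : {lrmorphism A i -> 'M[k]_n}), \tr (r (a i - c i *: 1)) = 0.
Proof.
move=> tr0.
have norm0 (rho : forall i, {n & {lrmorphism A i -> 'M[k]_n}}) :
    (forall i, 0 < tag (rho i))%N ->
    \sum_i (tag (rho i))%:R^-1 * \tr (tagged (rho i) (a i)) = 0.
  move=> n_gt0; have [D [g [D_gt0 gE]]] := common_rep n_gt0.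
  have Dn0 : D%:R != 0 :> k by rewrite natr_pchar0_eq0 // -lt0n.
  apply: (mulfI Dn0); rewrite mulr0 mulr_sumr -[RHS](tr0 D g) !raddf_sum.
  apply: eq_bigr => i _ /=; have [nD ->] := gE i.
  rewrite mulrA; congr (_ * _); rewrite -{1}(divnK nD) natrM mulfK //.
  by rewrite natr_pchar0_eq0 // -lt0n.
pose rho0 i : {n & {lrmorphism A i -> 'M[k]_n}} := Tagged _ (reg_rep (A i)).
pose c i := (tag (rho0 i))%:R^-1 * \tr (tagged (rho0 i) (a i)).
have rho0_gt0 i : (0 < tag (rho0 i))%N by exact: dim_falg_gt0.
exists c; split=> [|i [|n] r]; [exact: norm0|by rewrite /mxtrace big_ord0|].
pose rho := dfwith rho0 i (Tagged (fun n => {lrmorphism A i -> 'M[k]_n}) r).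
have rho_gt0 j : (0 < tag (rho j))%N.
  by rewrite /rho; case: dfwithP => // l _; apply: rho0_gt0.
have := norm0 rho rho_gt0; rewrite (bigD1 i) //= /rho dfwithin /=.
have := norm0 rho0 rho0_gt0; rewrite (bigD1 i) //= -/(c i) => c0.
rewrite (eq_bigr (fun j => c j)) => [|j ji]; last by rewrite dfwithout // eq_sym.
move: c0; rewrite -[X in _ + X]/(\sum_(j < m | j != i) c j).
move=> /eqP; rewrite addrC addr_eq0 => /eqP-> /eqP; rewrite subr_eq0 => /eqP ci.
rewrite raddfB /= raddfB /= linearZ_LR rmorph1 mxtraceZ mxtrace1 -ci.
by rewrite mulrAC mulVf ?mul1r ?subrr // natr_pchar0_eq0.
Qed.

End CommonReps.

Section TracelessElements.
Variables (k : closedFieldType) (k_pchar : [pchar k] =i pred0).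
Variables (m : nat) (m_gt0 : (0 < m)%N) (A : 'I_m -> falgType k) (P : algType k).
Variable iota : forall i, {lrmorphism A i -> P}.
Hypothesis hP : @is_free_product k 'I_m (fun i => A i) P iota.

Lemma traceless_jacobson x :
  (forall N (r : {lrmorphism P -> 'M[k]_N}), \tr (r x) = 0) ->
  exists b : forall i, A i, (forall i, jacobson_radical (A i) (b i)) /\
    x - \sum_i iota i (b i) \in comm_span P.
Proof.
move=> r0; have [y yc /(words_le1 m_gt0)[a xy]] := traceless_degree1 hP k_pchar r0.
have [|c [c0 ac]] := traceless_letters hP k_pchar (a := a).
  by move=> N r; rewrite -xy !raddfB /= r0 (mx_rep_trace_comm_span r yc) subrr.
have /(_ _)/cid2 b_ex i := traceless_decomposition k_pchar (ac i).
have [b [Jb ab]] : exists b : forall i, A i,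
    (forall i, jacobson_radical (A i) (b i)) /\
    forall i, a i - c i *: 1 - b i \in comm_span (A i).
  by exists (fun i => s2val (b_ex i)); split=> i; [apply: (s2valP (b_ex i))|
    apply: (s2valP' (b_ex i))].
exists b; split=> //.
(* The scalars [c i] disappear because they sum to zero. *)
have -> : x - \sum_i iota i (b i) = y + \sum_i iota i (a i - c i *: 1 - b i).
  have -> : \sum_i iota i (a i - c i *: 1 - b i) =
      \sum_i iota i (a i) - \sum_i c i *: 1 - \sum_i iota i (b i).
    rewrite -!sumrB; apply: eq_bigr => i _; rewrite !rmorphB; congr (_ - _ - _).
    by rewrite -[X in _ = _ *: X](rmorph1 (iota i)); apply: linearZ_LR.
  by rewrite -scaler_suml c0 scale0r subr0 -xy [RHS]addrA (addrC y) subrK.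
rewrite rpredD // rpred_sum // => i _; exact: (comm_span_map (iota i) (ab i)).
Qed.
End TracelessElements.

(** * Directness *)

Section AlgebraMatrices.
Variables (k : fieldType) (B : algType k) (n : nat).

(* An alias is needed because the canonical scaling on 'M[B]_n.+1 is by B. *)
Definition kmx : Type := 'M[B]_n.+1.

HB.instance Definition _ := GRing.NzRing.copy kmx 'M[B]_n.+1.

Definition kmx_scale (c : k) (M : kmx) : kmx := \matrix_(i, j) (c *: M i j).

Fact kmx_scaleA a b M : kmx_scale a (kmx_scale b M) = kmx_scale (a * b) M.
Proof. by apply/matrixP => i j; rewrite !mxE scalerA. Qed.

Fact kmx_scale1 : left_id 1 kmx_scale.
Proof. by move=> M; apply/matrixP => i j; rewrite !mxE scale1r. Qed.

Fact kmx_scaleDr : right_distributive kmx_scale +%R.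
Proof. by move=> a M N; apply/matrixP => i j; rewrite !mxE scalerDr. Qed.

Fact kmx_scaleDl M : {morph kmx_scale^~ M : a b / a + b}.
Proof. by move=> a b; apply/matrixP => i j; rewrite !mxE scalerDl. Qed.

HB.instance Definition _ := GRing.Zmodule_isLmodule.Build k kmx
  kmx_scaleA kmx_scale1 kmx_scaleDr kmx_scaleDl.

Fact kmx_scaleAl (a : k) (M N : kmx) : a *: (M * N) = a *: M * N.
Proof.
apply/matrixP => i j; rewrite !mxE scaler_sumr; apply: eq_bigr => l _.
by rewrite !mxE scalerAl.
Qed.

HB.instance Definition _ := GRing.Lmodule_isLalgebra.Build k kmx kmx_scaleAl.

Fact kmx_scaleAr (a : k) (M N : kmx) : a *: (M * N) = M * (a *: N).
Proof.
apply/matrixP => i j; rewrite !mxE scaler_sumr; apply: eq_bigr => l _.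
by rewrite !mxE scalerAr.
Qed.

HB.instance Definition _ := GRing.Lalgebra_isAlgebra.Build k kmx kmx_scaleAr.

Lemma kmxZE (a : k) (M : kmx) i j : (a *: M : kmx) i j = a *: M i j.
Proof. by rewrite mxE. Qed.

(* So the trace is well defined from kmx to B/[B, B]. *)
Lemma kmx_trace_comm_span (M : kmx) :
  M \in comm_span kmx -> \sum_i M i i \in comm_span B.
Proof.
move=> /comm_spanP[s ->].
have -> : \sum_i (\sum_(t <- s) t.1 *: (t.2.1 * t.2.2 - t.2.2 * t.2.1) : kmx) i i =
    \sum_(t <- s) t.1 *: \sum_i \sum_l
      (t.2.1 i l * t.2.2 l i - t.2.2 l i * t.2.1 i l).
  under eq_bigr do rewrite summxE; rewrite exchange_big; apply: eq_bigr => t _.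
  under eq_bigr do rewrite kmxZE; rewrite -scaler_sumr; congr (_ *: _).
  under eq_bigr do rewrite !mxE; rewrite sumrB.
  rewrite [X in _ - X]exchange_big -sumrB; apply: eq_bigr => i _.
  by rewrite sumrB.
apply: rpred_sum => t _; apply: comm_span_scale.
by do 2!apply: rpred_sum => ? _; apply: comm_span_comm.
Qed.

Fact diag_kmx_linear : linear (fun b : B => b%:M : kmx).
Proof. by move=> c a b; apply/matrixP => i j; rewrite !mxE mulrnDl scalerMnr. Qed.

Fact diag_kmx_mul : monoid_morphism (fun b : B => b%:M : kmx).
Proof. by split=> [|a b] //; rewrite -[RHS]/(_ *m _) -scalar_mxM. Qed.

Definition diag_kmx := alg_lrmorphism diag_kmx_linear diag_kmx_mul.

Variables (C : algType k) (r : {lrmorphism C -> 'M[k]_n.+1}).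

Definition extend_kmx_fun (c : C) : kmx := \matrix_(i, j) (r c i j *: 1).

Fact extend_kmx_linear : linear extend_kmx_fun.
Proof.
by move=> c a b; apply/matrixP => i j; rewrite !mxE linearP !mxE scalerDl scalerA.
Qed.

Fact extend_kmx_mul : monoid_morphism extend_kmx_fun.
Proof.
split=> [|a b]; apply/matrixP => i j.
  by rewrite !mxE rmorph1 mxE; case: eqP; rewrite ?scale1r ?scale0r.
rewrite !mxE rmorphM -[_ * _]/(_ *m _) mxE scaler_suml; apply: eq_bigr => l _.
by rewrite !mxE -scalerAl mul1r scalerA.
Qed.

Definition extend_kmx := alg_lrmorphism extend_kmx_linear extend_kmx_mul.

Lemma trace_extend_kmx c : \sum_i extend_kmx c i i = \tr (r c) *: 1.
Proof. by rewrite scaler_suml; apply: eq_bigr => i _; rewrite mxE. Qed.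

End AlgebraMatrices.

Section Directness.
Variables (k : closedFieldType) (k_pchar : [pchar k] =i pred0).
Variables (m : nat) (A : 'I_m -> falgType k) (P : algType k).
Variable iota : forall i, {lrmorphism A i -> P}.
Hypothesis hP : @is_free_product k 'I_m (fun i => A i) P iota.

Lemma jacobson_trace0 (C : falgType k) n (r : {lrmorphism C -> 'M[k]_n}) a :
  jacobson_radical C a -> \tr (r a) = 0.
Proof.
move=> /jacobson_nilpotent[j aj]; apply: (@mxtrace_nilpotent _ _ _ j).
by rewrite -rmorphXn aj rmorph0.
Qed.

(** [P] maps to matrices over [A i]: this factor goes to scalar matrices, the others to matrices
    over [k]. There the nilpotent [b j] have trace zero, so the trace modulo commutators leaves D +
    1 times [b i]. *)
Lemma jacobson_independent (b : forall i, A i) :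
  (forall i, jacobson_radical (A i) (b i)) ->
  \sum_i iota i (b i) \in comm_span P -> forall i, b i \in comm_span (A i).
Proof.
move=> Jb bP i.
have [D DE] : exists D, common_dim A = D.+1.
  by exists (common_dim A).-1; rewrite prednK // common_dim_gt0.
have dD j : (\dim {:A j} %| D.+1)%N by rewrite -DE dvdn_common_dim.
have /(_ _)/cid R_ex j := rep_multiple (reg_rep (A j)) (ltn0Sn D) (dD j).
pose R j := projT1 (R_ex j).
pose f := dfwith (fun j => extend_kmx (A i) (R j)) i (diag_kmx (A i) D).
have [g [gf _]] := hP f.
have := kmx_trace_comm_span (comm_span_map g bP).
rewrite rmorph_sum.
have -> : \sum_l (\sum_j g (iota j (b j)) : kmx (A i) D) l l = D.+1%:R *: b i.
  under eq_bigr do rewrite summxE.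
  rewrite exchange_big (bigD1 i) //= [X in _ + X]big1 => [|j ji]; last first.
    under eq_bigr do rewrite -[g _]/((g \o iota j) (b j)) gf /f dfwithout 1?eq_sym //.
    by rewrite trace_extend_kmx jacobson_trace0 // scale0r.
  rewrite addr0 -[X in _ = _ *: X]/(b i).
  under eq_bigr do rewrite -[g _]/((g \o iota i) (b i)) gf /f dfwithin mxE eqxx.
  by rewrite sumr_const card_ord scaler_nat.
move=> /(comm_span_scale D.+1%:R^-1).
by rewrite scalerA mulVf ?scale1r // natr_pchar0_eq0.
Qed.
End Directness.

Lemma jacobson_radical_submod (k : fieldType) (C : falgType k) (c : k) (a b : C) :
  jacobson_radical C a -> jacobson_radical C b -> jacobson_radical C (c *: a + b).
Proof.
move=> Ja Jb S Smax; have [[_ _ SM] _] := Smax.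
by rewrite -[c *: a]mulr_algl SM ?Ja ?Jb.
Qed.

Lemma jacobson_radical0 (k : fieldType) (C : falgType k) : jacobson_radical C 0.
Proof. by move=> S [[S0 _ _] _]. Qed.

Lemma cocenter_pi_eq0 (k : fieldType) (C : algType k) (c : C) :
  (cocenter_pi c = 0) <-> (c \in comm_span C).
Proof.
by rewrite -[0](raddf0 (@cocenter_pi k C)); split=> [/cocenter_piP|h];
  [|apply/cocenter_piP]; rewrite subr0.
Qed.

(** * The trace radical and residual finite-dimensionality of the free product *)

Section Main.
Variables (k : closedFieldType) (k_pchar : [pchar k] =i pred0).
Variables (m : nat) (m_gt0 : (0 < m)%N) (A : 'I_m -> falgType k) (P : algType k).
Variable iota : forall i, {lrmorphism A i -> P}.
Hypothesis hP : @is_free_product k 'I_m (fun i => A i) P iota.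

Lemma trace_radicalP (c : P) : trace_radical P (cocenter_pi c) <->
  exists b : forall i, A i, (forall i, jacobson_radical (A i) (b i)) /\
    cocenter_pi c = cocenter_pi (\sum_i iota i (b i)).
Proof.
(* Matrices of size 0 give no [fd_rep], but their trace is zero anyway. *)
split=> [c0|[b [Jb ->]] rho].
  have [|b [Jb bc]] := traceless_jacobson k_pchar m_gt0 hP (x := c).
    case=> [|N] r; first by rewrite /mxtrace big_ord0.
    have [rho [rhoE _]] := fd_rep_of_mx r (ltn0Sn N).
    by rewrite -rhoE -cocenter_traceE c0.
  by exists b; split=> //; apply/cocenter_piP.
rewrite cocenter_traceE; have [N [r [_ ->]]] := mx_of_fd_rep rho.
rewrite !raddf_sum big1 //= => i _.
exact: (jacobson_trace0 [the {lrmorphism A i -> 'M[k]_N} of r \o iota i] (Jb i)).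
Qed.

Lemma jacobson_image_choice (v : 'I_m -> cocenter P) :
  (forall i, (cocenter_map (iota i) @`
     (@cocenter_pi k (A i) @` jacobson_radical (A i))) (v i)) ->
  exists b : forall i, A i, forall i,
    jacobson_radical (A i) (b i) /\ v i = cocenter_pi (iota i (b i)).
Proof.
move=> vS; have /(_ _)/cid b_ex i : exists b : A i,
    jacobson_radical (A i) b /\ v i = cocenter_pi (iota i b).
  by have [_ [b Jb <-] <-] := vS i; exists b; rewrite cocenter_mapE.
by exists (fun i => projT1 (b_ex i)) => i; apply: (projT2 (b_ex i)).
Qed.

Lemma free_product_RFD : RFD P.
Proof.
move=> c c0; apply: contrapT => /forallNP nr; case/eqP: c0.
apply: (free_product_faithful hP k_pchar) => -[|N] r.
  by apply/matrixP => -[].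
have [rho [_ rhoE]] := fd_rep_of_mx r (ltn0Sn N).
by apply: rhoE; apply/eqP; move/negP: (nr rho); rewrite negbK.
Qed.

End Main.

Theorem corollary1p4 (k : closedFieldType) (hk : [pchar k] =i pred0)
    (m : nat) (hm : (1 <= m)%N) (A : 'I_m -> falgType k)
    (P : algType k) (iota : forall i : 'I_m, {lrmorphism A i -> P})
    (hP : @is_free_product k 'I_m (fun i => A i) P iota) :
  internal_direct_sum (trace_radical P)
    (fun i : 'I_m => cocenter_map (iota i) @`
       (@cocenter_pi k (A i) @` jacobson_radical (A i)))
  /\ (trace_RFD P <->
      forall (i : 'I_m) (a : A i),
        jacobson_radical (A i) a -> a \in comm_span (A i)).
Proof.
have SP i y : (cocenter_map (iota i) @`
      (@cocenter_pi k (A i) @` jacobson_radical (A i))) y <->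
    exists2 b, jacobson_radical (A i) b & y = cocenter_pi (iota i b).
  split=> [[_ [b Jb <-] <-]|[b Jb ->]]; first by exists b; rewrite ?cocenter_mapE.
  by exists (cocenter_pi b); [exists b|rewrite cocenter_mapE].
split; first split.
- move=> i; split; first rewrite inE; last move=> c x y; rewrite ?inE.
    by apply/SP; exists 0; [apply: jacobson_radical0|rewrite rmorph0 raddf0].
  move=> /SP[a Ja ->] /SP[b Jb ->]; apply/SP.
  exists (c *: a + b); first exact: jacobson_radical_submod.
  by rewrite linearP [RHS]linearP.
- apply/seteqP; split=> x.
    have [c ->] := cocenter_pi_surj x.
    move=> /(trace_radicalP hk hm hP)[b [Jb ->]].
    exists (fun i => cocenter_pi (iota i (b i))); last by rewrite raddf_sum.
    by move=> i; apply/SP; exists (b i).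
  move=> [v /jacobson_image_choice[b bP] <-].
  rewrite (eq_bigr _ (fun i _ => proj2 (bP i))) -raddf_sum.
  by apply/(trace_radicalP hk hm hP); exists b; split=> // i; case: (bP i).
- move=> v /jacobson_image_choice[b bP].
  rewrite (eq_bigr _ (fun i _ => proj2 (bP i))) -raddf_sum.
  move=> /cocenter_pi_eq0 /(jacobson_independent hk hP (fun i => proj1 (bP i))) bc i.
  by rewrite (proj2 (bP i)); apply/cocenter_pi_eq0/comm_span_map/bc.
split=> [[_ Ptr] i a Ja|JA].
  (* The family concentrated at [i]: its image is killed by all traces, hence zero in the cocenter,
     and independence gives the claim for [a]. *)
  pose b := dfwith (fun j : 'I_m => 0 : A j) i a.
  have Jb j : jacobson_radical (A j) (b j).
    by rewrite /b; case: dfwithP => // l _; apply: jacobson_radical0.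
  have <- : b i = a by rewrite /b dfwithin.
  apply: (jacobson_independent hk hP Jb); apply/cocenter_pi_eq0.
  apply: contrapT => /eqP/Ptr[rho]; apply/negP; rewrite negbK; apply/eqP.
  suff : trace_radical P (cocenter_pi (\sum_j iota j (b j))) by apply.
  by apply/(trace_radicalP hk hm hP); exists b.
split; first exact: (free_product_RFD hk hP).
move=> x; have [c ->] := cocenter_pi_surj x => x0.
apply: contrapT => /forallNP nr; case/eqP: x0.
have /(trace_radicalP hk hm hP)[b [Jb ->]] : trace_radical P (cocenter_pi c).
  by move=> rho; apply/eqP; move/negP: (nr rho); rewrite negbK.
apply/cocenter_pi_eq0/rpred_sum => i _.
exact/comm_span_map/JA/Jb.
Qed.
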